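(* Let $d\in\mathbb N$, $d\geq 1$, and let $\Omega\subset\mathbb R^d$ be a convex bounded domain. Let $f\in C(\mathbb R)$ satisfy $$|f(t)|\le C_H(1+|t|^\alpha)\quad\forall t\in\mathbb R$$ for some constant $C_H>0$ and an exponent $\alpha$ with $0<\alpha<\frac{d+2}{d-2}$ if $d>2$, and $1\le\alpha<\infty$ if $d\le2$. Suppose that the function $f_0:\mathbb R\to\mathbb R$ associated with $f$ (defined in the context) satisfies $$|f_0(t)|\le C_0(1+|t|^\beta)\quad\forall t\in\mathbb R$$ for some constant $C_0>0$ and some exponent $0\le\beta<1$. Then there exists a solution $u\in H^1_0(\Omega)$ of $$-\Delta u=f(u)\ \text{ in }\Omega,\qquad u=0\ \text{ on }\partial\Omega.$$
   Context: Let $\chi_+$ and $\chi_-$ be the characteristic functions of the positive and negative half-lines $\mathbb R_+$ and $\mathbb R_-$, and $f_+=\max\{f,0\}$, $f_-=\min\{f,0\}$. Then $f_0:=f_+\chi_++f_-\chi_-$; i.e. $f_0(t)=\max\{f(t),0\}$ for $t>0$ and $f_0(t)=\min\{f(t),0\}$ for $t<0$ (the value at $t=0$ is immaterial). The equation is understood in the weak sense, i.e. in $H^{-1}(\Omega)$: $\int_\Omega\nabla u\cdot\nabla\phi\,dx=\int_\Omega f(u)\,\phi\,dx$ for all $\phi\in H^1_0(\Omega)$. *)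

(* Defs.v *)
From HB Require Import structures.
From mathcomp Require Import all_boot all_order all_algebra.
From mathcomp Require Import all_classical all_reals all_analysis.
Set Implicit Arguments.
Unset Strict Implicit.
Unset Printing Implicit Defensive.
Import Order.TTheory GRing.Theory Num.Theory.
Import numFieldNormedType.Exports.
Local Open Scope classical_set_scope.
Local Open Scope ring_scope.

Definition measure_rV_display : measure_display -> measure_display.
Proof. exact. Qed.

Section measurable_rV.
Context {disp : measure_display} {T : measurableType disp} (d : nat).

Let coord : 'I_d -> 'rV[T]_d -> T := fun i v => v ord0 i.

Let rV_set0 : g_sigma_preimage coord set0.
Proof. exact: sigma_algebra0. Qed.

Let rV_setC A : g_sigma_preimage coord A -> g_sigma_preimage coord (~` A).
Proof. exact: sigma_algebraC. Qed.

Let rV_bigcup (F : (set 'rV[T]_d)^nat) : (forall i, g_sigma_preimage coord (F i)) ->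
  g_sigma_preimage coord (\bigcup_i F i).
Proof. exact: sigma_algebra_bigcup. Qed.

HB.instance Definition _ := @isMeasurable.Build (measure_rV_display disp)
  'rV[T]_d (g_sigma_preimage coord) rV_set0 rV_setC rV_bigcup.

Lemma measurable_rV_coord (i : 'I_d) :
  measurable_fun [set: 'rV[T]_d] (fun v => v ord0 i).
Proof.
move=> _ Y mY; rewrite setTI; apply: sub_sigma_algebra => /=.
rewrite -bigcup_seq/=; exists i => /=; first by rewrite mem_index_enum.
by exists Y => //; rewrite setTI.
Qed.

End measurable_rV.

Lemma measurable_fun_rVP d1 d2 (T1 : measurableType d1) (T2 : measurableType d2)
    (n : nat) (f : T1 -> 'rV[T2]_n) :
  measurable_fun [set: T1] f <->
  forall i, measurable_fun [set: T1] (fun x => f x ord0 i).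
Proof.
split=> [mf i|mf].
  by apply: (measurableT_comp (@measurable_rV_coord _ T2 n i)).
move=> _; apply: (@measurability _ _ _ _ _ _
  (\big[setU/set0]_(i < n) preimage_set_system setT
     (fun v : 'rV[T2]_n => v ord0 i) measurable)) => //.
move=> A [B]; rewrite -bigcup_seq/= => -[i _ [C mC <-]] <-.
by rewrite !setTI; have := mf i measurableT C mC; rewrite setTI.
Qed.

Section lebesgue_measure_rV.
Context {R : realType}.
Local Notation leb := (@lebesgue_measure R).

Definition rV_cons (d : nat) (p : R * 'rV[R]_d) : 'rV[R]_d.+1 :=
  \row_i oapp (p.2 ord0) p.1 (unlift ord0 i).

Definition rV_uncons (d : nat) (v : 'rV[R]_d.+1) : R * 'rV[R]_d :=
  (v ord0 ord0, \row_i v ord0 (lift ord0 i)).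

Lemma rV_cons0 d (p : R * 'rV[R]_d) : rV_cons p ord0 ord0 = p.1.
Proof. by rewrite mxE unlift_none. Qed.

Lemma rV_consS d (p : R * 'rV[R]_d) i :
  rV_cons p ord0 (lift ord0 i) = p.2 ord0 i.
Proof. by rewrite mxE liftK. Qed.

Lemma rV_consK d : cancel (@rV_cons d) (@rV_uncons d).
Proof.
move=> p; rewrite /rV_uncons rV_cons0; case: p => x v; congr (_, _).
by apply/rowP => i; rewrite mxE rV_consS.
Qed.

Lemma measurable_rV_cons d : measurable_fun setT (@rV_cons d).
Proof.
apply/measurable_fun_rVP => i; case: (unliftP ord0 i) => [j|] ->.
  under eq_fun do rewrite rV_consS.
  exact: (measurableT_comp (measurable_rV_coord j) measurable_snd).
by under eq_fun do rewrite rV_cons0; exact: measurable_fst.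
Qed.

Lemma measurable_rV_uncons d : measurable_fun setT (@rV_uncons d).
Proof.
apply/measurable_fun_pairP; split; first exact: (measurable_rV_coord ord0).
apply/measurable_fun_rVP => i /=.
under eq_fun do rewrite mxE.
exact: (measurable_rV_coord (lift ord0 i)).
Qed.

(* d-dimensional Lebesgue measure on the Borel sets of R^d, by slicing along
   the first coordinate; see lebesgue_rV_box for its values on boxes *)
Fixpoint lebesgue_rV (d : nat) : set 'rV[R]_d -> \bar R :=
  if d is d'.+1 then
    pushforward (leb \x @lebesgue_rV d')%E (@rV_cons d')
  else dirac (0 : 'rV[R]_0).

Let lebesgue_rV_ex d :
  exists mu : {sigma_finite_measure set 'rV[R]_d -> \bar R},
    @lebesgue_rV d = mu.
Proof.
elim: d => [|d [mu IH]].
  by exists [the {sigma_finite_measure set 'rV[R]_0 -> \bar R} of dirac (0 : 'rV[R]_0)].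
pose m : {measure set 'rV[R]_d.+1 -> \bar R} :=
  measure_function_pushforward__canonical__measure_function_Measure
    [the {measure set _ -> \bar R} of (leb \x mu)%E] (@measurable_rV_cons d).
have mE : @lebesgue_rV d.+1 = m by rewrite /= IH.
have sm : sigma_finite setT m.
  have /sigma_finiteP[F [TF ndF Foo]] := sigma_finiteT leb.
  have /sigma_finiteP[G [TG ndG Goo]] := sigma_finiteT mu.
  exists (fun n => @rV_uncons d @^-1` (F n `*` G n)).
    rewrite -preimage_bigcup (_ : \bigcup_n (F n `*` G n) = setT)//.
    apply/seteqP; split=> // -[x v] _.
    have [n _ Fnx] : (\bigcup_n F n) x by rewrite -TF.
    have [k _ Gkv] : (\bigcup_n G n) v by rewrite -TG.
    exists (maxn n k) => //; split.
      by move: x Fnx; exact/subsetPset/ndF/leq_maxl.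
    by move: v Gkv; exact/subsetPset/ndG/leq_maxr.
  move=> n; have [mF Fnoo] := Foo n; have [mG Gnoo] := Goo n; split.
    rewrite -[X in measurable X]setTI; apply: measurable_rV_uncons => //.
    exact: measurableX.
  rewrite /m/= /pushforward -comp_preimage (_ : _ \o _ = id); last first.
    by apply/funext => p; exact: rV_consK.
  by rewrite preimage_id product_measure1E// lte_mul_pinfty// ge0_fin_numE.
pose sm' := Measure_isSigmaFinite.Build _ _ _ m sm.
pose M : {sigma_finite_measure set 'rV[R]_d.+1 -> \bar R} :=
  HB.pack (m : set _ -> \bar R) m sm'.
by exists M.
Qed.

Let lebesgue_rV0 d : @lebesgue_rV d set0 = 0%E.
Proof. by have [mu ->] := lebesgue_rV_ex d. Qed.

Let lebesgue_rV_ge0 d A : (0 <= @lebesgue_rV d A)%E.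
Proof. by have [mu ->] := lebesgue_rV_ex d. Qed.

Let lebesgue_rV_sigma_additive d : semi_sigma_additive (@lebesgue_rV d).
Proof.
by have [mu ->] := lebesgue_rV_ex d; exact: measure_semi_sigma_additive.
Qed.

HB.instance Definition _ d := isMeasure.Build _ _ _ (@lebesgue_rV d)
  (@lebesgue_rV0 d) (@lebesgue_rV_ge0 d) (@lebesgue_rV_sigma_additive d).

Let lebesgue_rV_sigma_finite d : sigma_finite setT (@lebesgue_rV d).
Proof. by have [mu ->] := lebesgue_rV_ex d; exact: sigma_finiteT. Qed.

HB.instance Definition _ d := Measure_isSigmaFinite.Build _ _ _ (@lebesgue_rV d)
  (@lebesgue_rV_sigma_finite d).

Lemma lebesgue_rVS d :
  @lebesgue_rV d.+1 = pushforward (leb \x @lebesgue_rV d)%E (@rV_cons d).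
Proof. by []. Qed.

Lemma lebesgue_rV_box d (A : 'I_d -> set R) :
  (forall i, measurable (A i)) ->
  lebesgue_rV [set v : 'rV[R]_d | forall i, A i (v ord0 i)] =
    (\prod_(i < d) leb (A i))%E.
Proof.
elim: d A => [|d IH] A mA.
  by rewrite big_ord0 /lebesgue_rV diracE mem_set// => -[].
rewrite big_ord_recl -IH// lebesgue_rVS /pushforward.
set B := (X in _ = (_ * lebesgue_rV X)%E).
rewrite (_ : _ @^-1` _ = A ord0 `*` B); last first.
  apply/seteqP; split=> -[x v] /=.
    move=> Av; split; first by have := Av ord0; rewrite rV_cons0.
    by move=> i; have := Av (lift ord0 i); rewrite rV_consS.
  move=> [Ax Bv] i; case: (unliftP ord0 i) => [j|] ->.
    by rewrite rV_consS; exact: Bv.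
  by rewrite rV_cons0.
have mB : measurable B.
  rewrite (_ : B = \bigcap_(i in [set: 'I_d])
      ((fun v : 'rV[R]_d => v ord0 i) @^-1` A (lift ord0 i))).
    apply: fin_bigcap_measurable => // i _.
    by rewrite -[X in measurable X]setTI; exact: measurable_rV_coord.
  by apply/seteqP; split=> v /= Bv i; [move=> _; exact: Bv|exact: Bv].
exact: (product_measure1E leb (@lebesgue_rV d) (mA ord0) mB).
Qed.

End lebesgue_measure_rV.
Arguments lebesgue_rV : simpl never.

Section sobolev.
Context {R : realType} {d : nat}.
Local Notation E := 'rV[R]_d.
Local Notation mu := (@lebesgue_rV R d).
Implicit Types (Omega : set E) (u phi : E -> R) (Du Dphi : E -> E).

Definition is_domain Omega := [/\ open Omega, Omega !=set0 & connected Omega].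

Definition partial (i : 'I_d) phi : E -> R :=
  fun x => 'D_(delta_mx ord0 i) phi x.

Definition iter_partial (s : seq 'I_d) phi : E -> R := foldr partial phi s.

Definition smooth phi := forall s : seq 'I_d,
  continuous (iter_partial s phi) /\
  forall i x, derivable (iter_partial s phi) x (delta_mx ord0 i).

Definition supp phi : set E := closure [set x | phi x != 0].

Definition test_function Omega phi :=
  [/\ smooth phi, compact (supp phi) & supp phi `<=` Omega].

(* functions on Omega are total functions on R^d of which only the values on
   Omega matter: u \_ Omega is the extension of u by zero outside Omega *)
Definition L2 Omega u : Prop := u \_ Omega \in Lfun mu 2%:E.

Definition L2norm Omega u : \bar R := 'N[mu]_(2%:E)[EFin \o u \_ Omega].

Definition weak_gradient Omega u Du :=
  forall phi, test_function Omega phi -> forall i : 'I_d,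
    \int[mu]_(x in Omega) (u x * partial i phi x) =
    - \int[mu]_(x in Omega) (Du x ord0 i * phi x).

(* u belongs to H^1(Omega) and Du is its weak gradient, which is determined
   by u up to a null set *)
Definition H1 Omega u Du :=
  [/\ L2 Omega u,
      forall i, L2 Omega (fun x => Du x ord0 i) &
      weak_gradient Omega u Du].

(* u belongs to H^1_0(Omega), the closure in H^1(Omega) of the test functions,
   and Du is its weak gradient *)
Definition H1_0 Omega u Du :=
  H1 Omega u Du /\
  exists phi : (E -> R)^nat,
    [/\ forall n, test_function Omega (phi n),
        L2norm Omega (fun x => phi n x - u x) @[n --> \oo] --> 0%E &
        forall i, L2norm Omega (fun x => partial i (phi n) x - Du x ord0 i)
          @[n --> \oo] --> 0%E].

(* - Delta u = f(u) tested against H^1_0(Omega); the integrability clause rules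
   out that the right-hand side is the default value of a divergent integral *)
Definition weak_solution Omega (f : R -> R) u Du :=
  forall phi Dphi, H1_0 Omega phi Dphi ->
    mu.-integrable Omega (fun x => (f (u x) * phi x)%:E) /\
    \int[mu]_(x in Omega) (\sum_(i < d) Du x ord0 i * Dphi x ord0 i) =
    \int[mu]_(x in Omega) (f (u x) * phi x).

End sobolev.

Definition f_0 {R : realType} (f : R -> R) : R -> R := fun t =>
  Num.max (f t) 0 * \1_[set s : R | 0 < s] t +
  Num.min (f t) 0 * \1_[set s : R | s < 0] t.

(* Main.v *)
From HB Require Import structures.
Require Import Defs.
From mathcomp Require Import all_boot all_order all_algebra.
From mathcomp Require Import all_classical all_reals all_analysis.
From mathcomp Require Import measurable_realfun ring lra.

(** The solution is obtained by monotone iteration between the barriers [- q]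
    and [q], where [q] is a paraboloid in one coordinate that is positive on the
    domain and has a constant [- Delta q = 2 M].  Since the part [f_0] of the
    nonlinearity grows sublinearly, [M] can be taken so large that
    [f (q) < 2 M] and [f (- q) > - 2 M] ([exists_barrier_height]): [q] is a
    supersolution and [- q] is a subsolution.  Every function that occurs
    afterwards is trapped between them, hence bounded, so the integrals
    [f (u) phi] make sense without any embedding theorem.

    As [f] is only continuous, it is replaced by its sup-convolutions [F n], which
    are Lipschitz with constant [lam n], decrease with [n] and converge to [f]
    uniformly on the relevant interval ([supconv_approx]).  From [u 0 = q], the
    function [u n.+1] solves the linear problem
<<
      - Delta u(n+1) + lam(n) u(n+1) = F n (u n) + lam(n) u n.
>>
    It exists by minimising the energy over test functions: the parallelogram law
    makes minimising sequences Cauchy ([dirichlet_minimizing_sequence]) and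
    square-integrable functions are complete ([sqint_complete]).  The weak maximum
    principle ([comparison]) keeps [u n.+1] above [- q] and below [u n], and
    [u n.+1] is a supersolution for [F n.+1] because [F n + lam n] is increasing
    and [F n.+1 <= F n].

    Monotonicity replaces compactness.  The iterates decrease pointwise to some
    [v], and [- Delta u(n+1) = F n (u n) + lam n (u n - u n.+1)].  Here the first
    term tends to [f (v)] in mean by bounded convergence, while the integrals of
    [u n - u n.+1] are summable and [lam n] grows only linearly, so divergence of
    the harmonic series makes the second term small along a subsequence
    ([small_weighted_increment]).  Testing the difference of two such equations
    with the difference of the iterates, which is bounded, shows that the
    gradients are Cauchy; the limit is the required solution ([limit_solution]).

    The maximum principle needs the positive part of [h - q] as a test function.
    It is approximated by a smooth function [smooth_pos] of [phi - q] with [phi] a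
    test function near [h], and every error is estimated directly.  Weak gradients
    of limits come from integration by parts for test functions, that is, from the
    fact that the derivative of a compactly supported function has integral zero
    ([integral_partial0]). *)

Set Implicit Arguments.
Unset Strict Implicit.
Unset Printing Implicit Defensive.
Import Order.TTheory GRing.Theory Num.Theory.
Import numFieldNormedType.Exports.
Local Open Scope classical_set_scope.
Local Open Scope ring_scope.

(** * Square-integrable functions *)

HB.lock Definition ip {disp} {T : measurableType disp} {R : realType}
    (mu : {measure set T -> \bar R}) (D : set T) (f g : T -> R) : R :=
  \int[mu]_(x in D) (f x * g x).
Canonical ip_unlockable := Unlockable ip.unlock.
Arguments ip {disp T R} mu D f g.

Lemma ipE {disp} {T : measurableType disp} {R : realType}
    (mu : {measure set T -> \bar R}) (D : set T) (f g : T -> R) :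
  ip mu D f g = \int[mu]_(x in D) (f x * g x).
Proof. by rewrite unlock. Qed.

Section square_integrable.
Context {disp : measure_display} {T : measurableType disp} {R : realType}.
Variables (mu : {measure set T -> \bar R}) (D : set T).
Hypotheses (mD : measurable D) (finD : (mu D < +oo)%E).
Implicit Types f g h u v : T -> R.

Local Notation integ f := (mu.-integrable D (EFin \o f)).

Definition sqint f := measurable_fun D f /\ integ (fun x => f x ^+ 2).

Local Notation ip := (ip mu D).

Lemma le_integR f g : measurable_fun D f ->
  (forall x, D x -> `|f x| <= g x) -> integ g -> integ f.
Proof.
move=> mf fg; apply: le_integrable => //; first exact/measurable_EFinP.
by move=> x Dx; rewrite lee_fin (le_trans (fg _ Dx))// ler_norm.
Qed.

Lemma integD f g : integ f -> integ g -> integ (fun x => f x + g x).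
Proof. by move=> fi gi; exact: (integrableD mD fi gi). Qed.

Lemma integZ k f : integ f -> integ (fun x => k * f x).
Proof. by move=> fi; exact: (integrableZl mD k fi). Qed.

Lemma integ_cst (k : R) : integ (fun=> k).
Proof.
apply: measurable_bounded_integrable => //.
by exists `|k|; split; [exact: num_real|move=> M kM x _; exact: ltW].
Qed.

Lemma integM f g : sqint f -> sqint g -> integ (fun x => f x * g x).
Proof.
move=> [mf fi] [mg gi]; apply: (le_integR _ _ (integD fi gi)).
  exact: measurable_funM.
move=> x _; rewrite ler_norml; apply/andP; split.
  by rewrite -subr_ge0; have := sqr_ge0 (f x + g x);
     have := sqr_ge0 (f x); have := sqr_ge0 (g x); nra.
by rewrite -subr_ge0; have := sqr_ge0 (f x - g x);
   have := sqr_ge0 (f x); have := sqr_ge0 (g x); nra.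
Qed.

Lemma le_sqint f g : measurable_fun D f ->
  (forall x, D x -> `|f x| <= `|g x|) -> sqint g -> sqint f.
Proof.
move=> mf fg [mg gi]; split => //; apply: (le_integR _ _ gi).
  exact: measurable_funX.
move=> x Dx; rewrite normrX -[leRHS]ger0_norm ?sqr_ge0// normrX.
by rewrite lerXn2r ?nnegrE// fg.
Qed.

Lemma sqint_bounded f (C : R) : measurable_fun D f ->
  (forall x, D x -> `|f x| <= C) -> sqint f.
Proof.
move=> mf fC; apply: (@le_sqint f (fun=> C)) => //.
  by move=> x Dx; rewrite (le_trans (fC _ Dx))// ler_norm.
by split => //; exact: integ_cst.
Qed.

Lemma sqint_cst (C : R) : sqint (fun=> C).
Proof. by apply: (@sqint_bounded _ `|C|). Qed.

Lemma sqintZ k f : sqint f -> sqint (fun x => k * f x).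
Proof.
move=> [mf fi]; split; first exact: measurable_funM.
by under eq_fun do rewrite exprMn; exact: integZ.
Qed.

Lemma sqintD f g : sqint f -> sqint g -> sqint (fun x => f x + g x).
Proof.
move=> sf sg; have [mf fi] := sf; have [mg gi] := sg.
split; first exact: measurable_funD.
under eq_fun do rewrite sqrrD.
apply: integD => //; apply: integD => //.
by under eq_fun do rewrite -mulr_natl; exact/integZ/integM.
Qed.

Lemma sqintN f : sqint f -> sqint (fun x => - f x).
Proof. by move=> sf; under eq_fun do rewrite -mulN1r; exact: sqintZ. Qed.

Lemma sqintB f g : sqint f -> sqint g -> sqint (fun x => f x - g x).
Proof. by move=> sf sg; apply: sqintD => //; exact: sqintN. Qed.

Lemma sqint_norm f : sqint f -> sqint (fun x => `|f x|).
Proof.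
move=> [mf fi]; apply: (@le_sqint _ f) => //; last by move=> x _; rewrite normr_id.
exact: measurableT_comp.
Qed.

Lemma sqint_ext f g : (forall x, D x -> f x = g x) -> sqint f -> sqint g.
Proof.
move=> fg [mf fi]; have mg : measurable_fun D g.
  by apply: eq_measurable_fun mf => x /set_mem Dx; exact: fg.
by apply: (@le_sqint _ f) => // x Dx; rewrite fg.
Qed.

Lemma eq_ip f f' g g' : (forall x, D x -> f x = f' x) ->
  (forall x, D x -> g x = g' x) -> ip f g = ip f' g'.
Proof.
by move=> ff gg; rewrite !ipE; apply: eq_Rintegral => x /set_mem Dx; rewrite ff// gg.
Qed.

Lemma ipC f g : ip f g = ip g f.
Proof. by rewrite !ipE; apply: eq_Rintegral => x _; rewrite mulrC. Qed.

Lemma ipDl f g h : sqint f -> sqint g -> sqint h ->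
  ip (fun x => f x + g x) h = ip f h + ip g h.
Proof.
move=> sf sg sh; rewrite !ipE -RintegralD//; [|exact: integM..].
by apply: eq_Rintegral => x _; rewrite mulrDl.
Qed.

Lemma ipZl k f h : sqint f -> sqint h -> ip (fun x => k * f x) h = k * ip f h.
Proof.
move=> sf sh; rewrite !ipE -RintegralZl//; last exact: integM.
by apply: eq_Rintegral => x _; rewrite mulrA.
Qed.

Lemma ipNl f h : sqint f -> sqint h -> ip (fun x => - f x) h = - ip f h.
Proof.
move=> sf sh; rewrite -mulN1r -ipZl//.
by apply: eq_ip => // x _; rewrite mulN1r.
Qed.

Lemma ipBl f g h : sqint f -> sqint g -> sqint h ->
  ip (fun x => f x - g x) h = ip f h - ip g h.
Proof. by move=> sf sg sh; rewrite ipDl ?ipNl//; exact: sqintN. Qed.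

Lemma ipDr f g h : sqint f -> sqint g -> sqint h ->
  ip h (fun x => f x + g x) = ip h f + ip h g.
Proof. by move=> sf sg sh; rewrite ipC ipDl// !(ipC h). Qed.

Lemma ipZr k f h : sqint f -> sqint h -> ip h (fun x => k * f x) = k * ip h f.
Proof. by move=> sf sh; rewrite ipC ipZl// ipC. Qed.

Lemma ipBr f g h : sqint f -> sqint g -> sqint h ->
  ip h (fun x => f x - g x) = ip h f - ip h g.
Proof. by move=> sf sg sh; rewrite ipC ipBl// !(ipC h). Qed.

Lemma ip_ge0 f g : (forall x, D x -> 0 <= f x * g x) -> 0 <= ip f g.
Proof. by move=> fg; rewrite ipE; exact: Rintegral_ge0. Qed.

Lemma ipff_ge0 f : 0 <= ip f f.
Proof. by apply: ip_ge0 => x _; rewrite -expr2 sqr_ge0. Qed.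

(** The algebra behind both the Cauchy-Schwarz inequality and the Euler equation
    of an approximate minimiser. *)
Lemma nneg_quadratic_discr (a b c : R) : 0 <= a ->
  (forall t, 0 <= a * t ^+ 2 + 2 * b * t + c) -> b ^+ 2 <= a * c.
Proof.
move=> a0 h; have [a_gt0|] := ltP 0 a.
  (* The minimum of the quadratic. *)
  have := h (- b / a); have -> : a * (- b / a) ^+ 2 + 2 * b * (- b / a) + c =
    (a * c - b ^+ 2) / a by field; rewrite gt_eqF.
  by rewrite pmulr_lge0 ?invr_gt0// subr_ge0.
move=> a_le0; have -> : a = 0 by apply/eqP; rewrite eq_le a_le0.
rewrite mul0r; have [->|b0] := eqVneq b 0; first by rewrite expr0n.
(* The affine function 2 b t + c takes the value -1 here. *)
have := h (- (c + 1) / (2 * b)); have -> : a = 0 by apply/eqP; rewrite eq_le a_le0.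
rewrite mul0r add0r mulrCA divff ?mulr1 ?mulf_neq0// ?pnatr_eq0//.
by rewrite opprD addrAC addNr add0r; lra.
Qed.

Lemma ip_CS f g : sqint f -> sqint g -> ip f g ^+ 2 <= ip f f * ip g g.
Proof.
move=> sf sg; apply: nneg_quadratic_discr; first exact: ipff_ge0.
move=> t; have stf := sqintZ t sf; have s2 := sqintD stf sg.
have := ipff_ge0 (fun x => t * f x + g x).
by rewrite ipDl// !ipDr// !ipZl// !ipZr// (ipC g f); congr (0 <= _); ring.
Qed.

Lemma ip_CS_abs f g : sqint f -> sqint g ->
  `|ip f g| <= Num.sqrt (ip f f) * Num.sqrt (ip g g).
Proof.
move=> sf sg; rewrite -sqrtrM ?ipff_ge0// -sqrtr_sqr.
by rewrite ler_sqrt ?mulr_ge0 ?ipff_ge0// ip_CS.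
Qed.

Lemma ip_sqD f g : sqint f -> sqint g ->
  ip (fun x => f x + g x) (fun x => f x + g x) <= 2 * (ip f f + ip g g).
Proof.
move=> sf sg; have s2 := sqintD sf sg; have s1 := sqintB sf sg.
have := ipff_ge0 (fun x => f x - g x).
by rewrite ipBl// !ipBr// ipDl// !ipDr// (ipC g f); lra.
Qed.

Lemma ip_norm f : ip (fun x => `|f x|) (fun x => `|f x|) = ip f f.
Proof.
by rewrite !ipE; apply: eq_Rintegral => x _; rewrite -!expr2 -normrX ger0_norm ?sqr_ge0.
Qed.

Lemma le_ip f g u v : integ (fun x => f x * g x) -> integ (fun x => u x * v x) ->
  (forall x, D x -> f x * g x <= u x * v x) -> ip f g <= ip u v.
Proof. by move=> i1 i2 h; rewrite !ipE; exact: le_Rintegral. Qed.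

Lemma ip0l g : ip (fun=> 0) g = 0.
Proof. by rewrite ipE; under eq_Rintegral do rewrite mul0r; rewrite Rintegral_cst// mul0r. Qed.

End square_integrable.

Section completeness.
Context {disp : measure_display} {T : measurableType disp} {R : realType}.
Variables (mu : {measure set T -> \bar R}) (D : set T).
Hypotheses (mD : measurable D) (finD : (mu D < +oo)%E).
Local Notation sqint := (sqint mu D).
Local Notation ip := (ip mu D).
Local Notation nrm2 f := (ip f f).

Lemma measurable_EFin (f : T -> R) :
  measurable_fun D f -> measurable_fun D (fun x => (f x)%:E).
Proof. by move/measurable_EFinP. Qed.

Lemma ip_EFin (f : T -> R) : sqint f ->
  (\int[mu]_(x in D) (f x ^+ 2)%:E)%E = (nrm2 f)%:E.
Proof.
move=> [mf fi]; rewrite ipE /Rintegral fineK; last first.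
  by under eq_fun do rewrite -expr2; exact: integrable_fin_num.
by apply: eq_integral => x _; rewrite expr2.
Qed.

(** The squared increments, weighted by [4 ^ k], have an integrable sum.  Where
    that sum is finite it bounds the [k]-th increment by a multiple of
    [2 ^ -k], so the sequence converges there. *)
Lemma fast_cauchy_cvg_ae (w : (T -> R)^nat) : (forall k, sqint (w k)) ->
  (forall k, nrm2 (fun x => w k.+1 x - w k x) <= 8^-1 ^+ k) ->
  {ae mu, forall x, D x -> cvgn (fun k => w k x)}.
Proof.
move=> sw hw; pose g k := EFin \o (fun x => 4 ^+ k * (w k.+1 x - w k x) ^+ 2).
have sdw k : sqint (fun x => w k.+1 x - w k x) by apply: sqintB.
have mg k : measurable_fun D (g k).
  apply/measurable_EFinP/measurable_funM => //; apply: measurable_funX.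
  by case: (sdw k).
have g0 k x : D x -> (0 <= g k x)%E.
  by move=> _; rewrite lee_fin mulr_ge0 ?sqr_ge0// exprn_ge0.
have Ig k : (\int[mu]_(x in D) g k x <= (geometric 1 2^-1 k)%:E)%E.
  rewrite /g/=; under eq_integral do rewrite EFinM.
  rewrite ge0_integralZl//; last 2 first.
  - by apply: measurable_EFin; apply: measurable_funX; case: (sdw k).
  - by move=> x _; rewrite lee_fin sqr_ge0.
  rewrite ip_EFin// -EFinM lee_fin.
  apply: (le_trans (ler_wpM2l _ (hw k))); first by rewrite exprn_ge0.
  by rewrite -exprMn /geometric/= mul1r le_eqVlt; apply/orP; left; apply/eqP; congr (_ ^+ _); field.
have SI : (\int[mu]_(x in D) (\sum_(0 <= k <oo) g k x) < +oo)%E.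
  rewrite integral_nneseries//; apply: (@le_lt_trans _ _ (\sum_(0 <= k <oo) (geometric 1 2^-1 k)%:E)%E).
    apply: lee_nneseries => [k _ _|k _]; last exact: Ig.
    by apply: integral_ge0; exact: g0.
  rewrite (_ : (fun n => _) = EFin \o series (geometric 1 2^-1)).
    rewrite EFin_lim ?ltry//.
    by apply: is_cvg_geometric_series; rewrite ger0_norm; lra.
  by apply/funext => n /=; rewrite sumEFin.
have iS : mu.-integrable D (fun x => \sum_(0 <= k <oo) g k x)%E.
  apply/integrableP; split.
    by apply: ge0_emeasurable_sum => // k x Dx _; exact: g0.
  under eq_integral => x /set_mem Dx.
    rewrite gee0_abs; last by apply: nneseries_ge0 => k _ _; exact: g0.
    over.
  exact: SI.
have := integrable_ae mD iS; apply: filterS => x + Dx => /(_ Dx) fin.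
set c := (\sum_(0 <= k <oo) g k x)%E in fin.
have gc k : 4 ^+ k * (w k.+1 x - w k x) ^+ 2 <= fine c.
  rewrite -lee_fin fineK//.
  apply: (@le_trans _ _ (\sum_(0 <= i < k.+1) g i x)%E).
    rewrite big_nat_recr//= leeDr//.
    by apply: sume_ge0 => i _; exact: g0.
  by apply: nneseries_lim_ge => i _ _; exact: g0.
have dk k : `|telescope (w ^~ x) k| <= geometric (Num.sqrt (fine c)) 2^-1 k.
  rewrite /geometric/= /telescope -sqrtr_sqr.
  have -> : 2^-1 ^+ k = Num.sqrt (4^-1 ^+ k) :> R.
    by rewrite -[LHS]ger0_norm ?exprn_ge0// -sqrtr_sqr exprAC; congr (Num.sqrt (_ ^+ _)); field.
  have c0 : 0 <= fine c by apply: le_trans (gc 0%N); rewrite mulr_ge0 ?sqr_ge0.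
  rewrite -sqrtrM// ler_sqrt; last by rewrite mulr_ge0// exprn_ge0.
  rewrite exprVn ler_pdivlMr ?exprn_gt0// mulrC; exact: gc.
have : cvgn (series (telescope (w ^~ x))).
  apply: normed_cvg; apply: series_le_cvg dk _ => //.
    by move=> k; rewrite /geometric/= mulr_ge0 ?sqrtr_ge0 ?exprn_ge0.
  by apply: is_cvg_geometric_series; rewrite ger0_norm; lra.
rewrite telescopeK => /cvg_ex[l hl]; apply/cvg_ex; exists (l + w 0%N x).
rewrite (_ : (fun k => w k x) = fun k => (w k x - w 0%N x) + w 0%N x).
  by apply: cvgD => //; exact: cvg_cst.
by apply/funext => k; rewrite subrK.
Qed.

Definition cauchy2 (u : (T -> R)^nat) := forall e : R, 0 < e ->
  exists N, forall n m, (N <= n)%N -> (N <= m)%N -> nrm2 (fun x => u n x - u m x) <= e.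

Lemma cauchy2_fast_subseq u : cauchy2 u -> exists phi : nat -> nat,
  (forall k, (k <= phi k)%N) /\
  forall k, nrm2 (fun x => u (phi k.+1) x - u (phi k) x) <= 8^-1 ^+ k.
Proof.
move=> cu; have /choice[N hN] k : exists N, forall n m, (N <= n)%N -> (N <= m)%N ->
    nrm2 (fun x => u n x - u m x) <= 8^-1 ^+ k.
  by apply: cu; rewrite exprn_gt0// invr_gt0.
pose M k := \max_(i < k.+1) (maxn i (N i)).
have hM i k : (i <= k)%N -> (maxn i (N i) <= M k)%N.
  by move=> ik; exact: (@leq_bigmax _ (fun j : 'I_k.+1 => maxn j (N j)) (Ordinal (ik : (i < k.+1)%N))).
exists M; split=> k; first by apply: leq_trans (hM k k (leqnn _)); rewrite leq_maxl.
apply: hN; first by apply: leq_trans (hM k k.+1 _); rewrite ?leq_maxr.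
by apply: leq_trans (hM k k _); rewrite ?leq_maxr.
Qed.

(** Riesz-Fischer: the limit is read off a fast subsequence, and Fatou's lemma
    turns the Cauchy estimate into convergence of the whole sequence. *)
Lemma sqint_complete u : (forall n, sqint (u n)) -> cauchy2 u ->
  exists2 l, sqint l & forall e : R, 0 < e ->
    exists N, forall n, (N <= n)%N -> nrm2 (fun x => u n x - l x) <= e.
Proof.
move=> su cu; have [phi [phi_ge hphi]] := cauchy2_fast_subseq cu.
pose w k := u (phi k).
have aecv := @fast_cauchy_cvg_ae w (fun k => su _) hphi.
pose l x := fine (limn_esup (fun k => (w k x)%:E)).
have mw k : measurable_fun D (w k) by case: (su (phi k)).
have ml : measurable_fun D l.
  apply: measurableT_comp; first exact: fine_measurable.
  by apply: measurable_fun_limn_esup => k; exact: measurable_EFin.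
have wl : {ae mu, forall x, D x -> w ^~ x @ \oo --> l x}.
  apply: filterS aecv => x cx Dx; have /cvg_ex[y wy] := cx Dx.
  suff -> : l x = y by [].
  rewrite /l; have /cvg_limn_einf_sup[_ ->//] : (w k x)%:E @[k --> \oo] --> y%:E.
  by apply: cvg_EFin => //; exact: nearW.
have key e : 0 < e -> exists N, forall n, (N <= n)%N ->
    (\int[mu]_(x in D) ((u n x - l x) ^+ 2)%:E <= e%:E)%E.
  move=> e0; have [N hN] := cu _ e0; exists N => n Nn.
  pose v k x := ((u n x - w (k + N)%N x) ^+ 2)%:E.
  have sd k : sqint (fun x => u n x - w (k + N)%N x) by apply: sqintB => //; exact: su.
  have msq k : measurable_fun D (v k).
    by apply: measurable_EFin; apply: measurable_funX; case: (sd k).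
  have v0 k x : D x -> (0 <= v k x)%E by move=> _; rewrite lee_fin sqr_ge0.
  have <- : (\int[mu]_(x in D) limn_einf (v ^~ x) =
             \int[mu]_(x in D) ((u n x - l x) ^+ 2)%:E)%E.
    apply: ae_eq_integral => //.
    - rewrite (_ : (fun x => _) = fun x => oppe (limn_esup (fun k => oppe (v k x)))).
        apply: measurableT_comp => //; apply: measurable_fun_limn_esup => k.
        exact: measurableT_comp.
      by apply/funext => x; rewrite limn_esupN oppeK.
    - apply: measurable_EFin; apply: measurable_funX; apply: measurable_funB => //.
      by case: (su n).
    - apply: filterS wl => x wx Dx.
      have /cvg_limn_einf_sup[-> _//] : v ^~ x @ \oo --> ((u n x - l x) ^+ 2)%:E.
      apply: cvg_EFin; first exact: nearW.
      have cw : w (k + N)%N x @[k --> \oo] --> l x.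
        by have := wx Dx; rewrite -(cvg_shiftn N).
      have cd : (u n x - w (k + N)%N x) @[k --> \oo] --> u n x - l x.
        by apply: cvgB => //; exact: cvg_cst.
      by rewrite expr2; exact: (cvgM cd cd).
  apply: (le_trans (fatou mu mD msq v0)); apply: (le_trans (limn_einf_sup _)).
  rewrite limn_esup_lim; apply: lime_le; first exact: is_cvg_esups.
  apply: nearW => m; apply: ub_ereal_sup => _ [k _ <-].
  rewrite ip_EFin// lee_fin; apply: hN => //.
  by apply: leq_trans (phi_ge _); rewrite leq_addl.
(* The limit is square-integrable because it is at finite distance from a term. *)
have [N1 hN1] := key 1 ltr01.
have sl : sqint l.
  have sd : sqint (fun x => u N1 x - l x).
    have md : measurable_fun D (fun x => u N1 x - l x).
      by apply: measurable_funB => //; case: (su N1).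
    split => //; apply/integrableP; split.
      by apply: measurable_EFin; exact: measurable_funX.
    apply: (@le_lt_trans _ _ 1%:E); last by rewrite ltry.
    apply: le_trans (hN1 N1 (leqnn _)); rewrite le_eqVlt; apply/orP; left; apply/eqP.
    by apply: eq_integral => x _ /=; rewrite ger0_norm ?sqr_ge0.
  have := sqintB mD (su N1) sd; apply: sqint_ext => // x _.
  by rewrite subKr.
exists l => // e e0; have [N hN] := key _ e0; exists N => n Nn.
by rewrite -lee_fin -ip_EFin ?hN//; apply: sqintB.
Qed.

End completeness.

Section sum_of_products.
Context {disp : measure_display} {T : measurableType disp} {R : realType}.
Variables (mu : {measure set T -> \bar R}) (D : set T).
Hypothesis mD : measurable D.

Lemma Rintegral_sum_ip n (U V : 'I_n -> T -> R) : (forall i, sqint mu D (U i)) ->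
  (forall i, sqint mu D (V i)) ->
  \int[mu]_(x in D) (\sum_(i < n) U i x * V i x) = \sum_(i < n) ip mu D (U i) (V i).
Proof.
move=> sU sV.
suff [_ h] : mu.-integrable D (EFin \o (fun x => \sum_(i < n) U i x * V i x)) /\
  \int[mu]_(x in D) (\sum_(i < n) U i x * V i x) = \sum_(i < n) ip mu D (U i) (V i) by [].
elim: n U V sU sV => [|n IH] U V sU sV.
  rewrite big_ord0; split.
    rewrite (_ : _ \o _ = cst 0%E); first exact: integrable0.
    by apply/funext => x /=; rewrite big_ord0.
  by under eq_Rintegral do rewrite big_ord0; rewrite Rintegral_cst// mul0r.
have [iI eI] := IH (fun i => U (lift ord0 i)) (fun i => V (lift ord0 i))
  (fun i => sU _) (fun i => sV _).
have i0 : mu.-integrable D (EFin \o (fun x => U ord0 x * V ord0 x)) by exact: integM.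
have E : (fun x => \sum_(i < n.+1) U i x * V i x) =
    fun x => U ord0 x * V ord0 x + \sum_(i < n) U (lift ord0 i) x * V (lift ord0 i) x.
  by apply/funext => x; rewrite big_ord_recl.
rewrite E; split; first exact: integD.
by rewrite RintegralD// eI big_ord_recl ipE.
Qed.

End sum_of_products.

Section L1_distance.
Context {disp : measure_display} {T : measurableType disp} {R : realType}.
Variables (mu : {measure set T -> \bar R}) (D : set T).
Hypotheses (mD : measurable D) (finD : (mu D < +oo)%E).
Local Notation sq := (sqint mu D).
Local Notation ip := (ip mu D).
Implicit Types g h : T -> R.

(** The [L^1] norm, as a product so that the rules for [ip] apply to it. *)
Definition l1 g := ip (fun x => `|g x|) (fun=> 1).

Lemma l1D g h : sq g -> sq h -> l1 (fun x => g x + h x) <= l1 g + l1 h.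
Proof.
move=> sg sh; have s1 := sqint_cst mD finD 1.
have sng := sqint_norm mD sg; have snh := sqint_norm mD sh.
rewrite /l1 -ipDl//; apply: le_ip => //.
- by apply: integM => //; apply: sqint_norm => //; exact: sqintD.
- by apply: integM => //; exact: sqintD.
- by move=> x Dx; rewrite !mulr1 ler_normD.
Qed.

Lemma ip_l1 g h (C : R) : sq g -> sq h -> (forall x, D x -> `|h x| <= C) ->
  `|ip g h| <= C * l1 g.
Proof.
move=> sg sh hC; have s1 := sqint_cst mD finD 1; have sC := sqint_cst mD finD C.
have sng := sqint_norm mD sg; have snh := sqint_norm mD sh.
have bound (g' : T -> R) : sq g' -> (forall x, D x -> `|g' x| = `|g x|) -> ip g' h <= C * l1 g.
  move=> sg' gg; have -> : C * l1 g = ip (fun x => `|g x|) (fun=> C).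
    by rewrite /l1 -ipZr//; apply: eq_ip => // x _; rewrite mulr1.
  apply: le_ip => //; [exact: integM|exact: integM|].
  move=> x Dx; apply: le_trans (ler_norm _) _; rewrite normrM gg//.
  by rewrite ler_wpM2l// hC.
rewrite ler_norml; apply/andP; split; last exact: bound.
rewrite lerNl -ipNl//; apply: bound; first exact: sqintN.
by move=> x _; rewrite normrN.
Qed.

Lemma bounded_cvg_l1 (g_ : nat -> T -> R) g (C : R) : (forall n, measurable_fun D (g_ n)) ->
  (forall n x, D x -> `|g_ n x| <= C) -> (forall x, D x -> g_ ^~ x @ \oo --> g x) ->
  forall e : R, 0 < e -> exists N, forall n, (N <= n)%N -> l1 (fun x => g_ n x - g x) <= e.
Proof.
move=> mg gC gcvg e e0; have mg' : measurable_fun D g by apply: measurable_fun_cvg gcvg.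
have mgE n : measurable_fun D (EFin \o g_ n) by exact/measurable_EFinP.
have mgE' : measurable_fun D (EFin \o g) by exact/measurable_EFinP.
have iC := integ_cst mD finD C.
have c1 : {ae mu, forall x, D x -> (EFin \o g_ n) x @[n --> \oo] --> (EFin \o g) x}.
  apply: aeW => x Dx; apply: cvg_EFin; first exact: nearW.
  exact: gcvg.
have c2 : {ae mu, forall x n, D x -> (`|(EFin \o g_ n) x| <= (EFin \o (fun=> C)) x)%E}.
  by apply: aeW => x n Dx; rewrite /= lee_fin gC.
have [_ h _] := dominated_convergence mD mgE mgE' c1 iC c2.
have s1 := sqint_cst mD finD 1.
have gC' x : D x -> `|g x| <= C.
  move=> Dx; have cn : `|g_ n x| @[n --> \oo] --> `|g x|.
    exact: (cvg_comp _ _ (gcvg x Dx) (@norm_continuous _ R^o (g x))).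
  rewrite -(cvg_lim _ cn)//; apply: limr_le; first by apply/cvg_ex; exists `|g x|.
  by apply: nearW => n; exact: gC.
have sgn n : sq (g_ n) by apply: (sqint_bounded mD finD (mg n) (gC n)).
have sg : sq g by apply: (sqint_bounded mD finD mg' gC').
have sd n : sq (fun x => g_ n x - g x) by exact: sqintB.
have l1E n : (\int[mu]_(x in D) `|(EFin \o g_ n) x - (EFin \o g) x|)%E =
    (l1 (fun x => g_ n x - g x))%:E.
  rewrite /l1 ipE /Rintegral fineK; first by apply: eq_integral => x _ /=; rewrite mulr1.
  by apply: integrable_fin_num => //; apply: integM => //; exact: sqint_norm.
move: h; rewrite (_ : [sequence _]_n = fun n => (l1 (fun x => g_ n x - g x))%:E); last first.
  by apply/funext => n; exact: l1E.
move=> /fine_cvgP[_] /cvgrPdist_le/(_ _ e0)[N _ hN]; exists N => n Nn.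
have := hN n Nn; rewrite /= sub0r normrN ger0_norm//.
by apply: ip_ge0 => x _; rewrite mulr1.
Qed.

End L1_distance.

(** * Minimising a quadratic functional *)

Section dirichlet_principle.
Context {R : realType} {X : lmodType R}.
Variables (S : set X) (a : X -> X -> R) (l : X -> R) (K : R).
Hypotheses (S0 : S 0) (SD : forall x y, S x -> S y -> S (x + y))
  (SZ : forall k x, S x -> S (k *: x)).
Hypotheses (aC : forall x y, a x y = a y x) (a0 : forall x, 0 <= a x x)
  (aD : forall x y z, S x -> S y -> S z -> a (x + y) z = a x z + a y z)
  (aZ : forall k x z, S x -> S z -> a (k *: x) z = k * a x z)
  (lD : forall x y, S x -> S y -> l (x + y) = l x + l y)
  (lZ : forall k x, S x -> l (k *: x) = k * l x)
  (bnd : forall x, S x -> - K <= a x x - 2 * l x).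

Let J x := a x x - 2 * l x.

Let JD x y t : S x -> S y ->
  J (x + t *: y) = J x + 2 * t * (a x y - l y) + t ^+ 2 * a y y.
Proof.
move=> Sx Sy; have St := SZ t Sy; have Sxy := SD Sx St.
rewrite /J lD// lZ// aD// (aC x (x + _)) (aC (t *: y) (x + _)) !aD//.
by rewrite (aC x (t *: y)) !aZ// (aC y (t *: y)) aZ// (aC y x); ring.
Qed.

(** Minimising sequences of a coercive quadratic functional are Cauchy for the
    energy by the parallelogram law, and solve the Euler equation up to an
    error that is controlled by the energy of the test vector. *)
Lemma dirichlet_minimizing_sequence : exists p : nat -> X,
  [/\ forall n, S (p n),
      forall n m, a (p n - p m) (p n - p m) <= 2 * (n.+1%:R^-1 + m.+1%:R^-1) &
      forall n y, S y -> (a (p n) y - l y) ^+ 2 <= a y y * n.+1%:R^-1].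
Proof.
have hasinf : has_inf (J @` S).
  by split; [exists (J 0), 0|exists (- K) => _ [x Sx <-]; exact: bnd].
set m := inf (J @` S).
have mJ x : S x -> m <= J x by move=> Sx; apply: ge_inf; [case: hasinf|exists x].
have /choice[p hp] n : exists x, S x /\ J x <= m + n.+1%:R^-1.
  have e0 : 0 < n.+1%:R^-1 :> R by rewrite invr_gt0.
  have [_ [x Sx <-] Jx] := inf_adherent e0 hasinf.
  by exists x; split => //; exact: ltW.
have Sp n : S (p n) by case: (hp n).
exists p; split => // [n k|n y Sy].
  have Sd : S (p n - p k) by apply: SD => //; rewrite -scaleN1r; exact: SZ.
  (* The functional at p k, at p n and at their midpoint. *)
  have := JD (2^-1) (Sp k) Sd; set y := p n - p k in Sd *.
  have := JD 1 (Sp k) Sd; rewrite scale1r -/y.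
  have -> : p k + y = p n by rewrite /y addrC subrK.
  have := mJ _ (SD (Sp k) (SZ (2^-1) Sd)).
  have := hp n; have := hp k => -[_ hk] [_ hn].
  move: (J (p k + _)) (J (p n)) (J (p k)) (a (p k) y - l y) (a y y) hk hn.
  move: (n.+1%:R^-1) (k.+1%:R^-1) => r s j1 j2 j3 e A; rewrite !expr2; lra.
apply: nneg_quadratic_discr => // t.
have := mJ _ (SD (Sp n) (SZ t Sy)); rewrite JD//.
have [_] := hp n; move: (J (p n)) (a (p n) y - l y) (a y y) (n.+1%:R^-1) => j e A r; rewrite !expr2; lra.
Qed.

End dirichlet_principle.

(** * Borel sets of the Euclidean space *)

Section borel_rV.
Context {R : realType} {d : nat}.
Local Notation E := 'rV[R]_d.
Local Notation mu := (@lebesgue_rV R d).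

Lemma rV_ballE (x y : E) e : 0 < e ->
  ball x e y <-> forall i, `|x ord0 i - y ord0 i| < e.
Proof.
move=> e0; split=> [[_ h] i|h]; first exact: (h ord0 i).
by split=> // i j; rewrite ord1; exact: h.
Qed.

Lemma le_coord_norm (x : E) i : `|x ord0 i| <= `|x|.
Proof.
rewrite [leRHS]mx_normrE.
exact: (le_bigmax _ (fun ij => `|x ij.1 ij.2|) (ord0, i)).
Qed.

Lemma measurable_box (A : 'I_d -> set R) : (forall i, measurable (A i)) ->
  measurable [set v : E | forall i, A i (v ord0 i)].
Proof.
move=> mA; rewrite (_ : [set v | _] =
    \bigcap_(i in [set: 'I_d]) ((fun v : E => v ord0 i) @^-1` A i)).
  apply: fin_bigcap_measurable => // i _.
  by rewrite -[X in measurable X]setTI; exact: measurable_rV_coord.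
by apply/seteqP; split=> v /= Av i; [move=> _; exact: Av|exact: Av].
Qed.

Lemma measurable_rV_ball (x : E) e : measurable (ball x e).
Proof.
have [e0|e0] := ltP 0 e; last first.
  rewrite (_ : ball x e = set0)//; apply/seteqP; split=> // y.
  by move=> [+ _]; rewrite ltNge e0.
rewrite (_ : ball x e = [set v : E | forall i, ball (x ord0 i) e (v ord0 i)]).
  by apply: (measurable_box (A := fun i => ball (x ord0 i) e)) => i; exact: measurable_ball.
by apply/seteqP; split=> y /rV_ballE; apply.
Qed.

(** Rational balls form a countable base, so the product sigma-algebra of
    [R^d] contains its open sets. *)
Lemma open_measurable_rV (U : set E) : open U -> measurable U.
Proof.
move=> oU; pose c (q : 'rV[rat]_d) : E := map_mx (@ratr R) q.
pose F (p : 'rV[rat]_d * nat) :=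
  if `[< ball (c p.1) p.2.+1%:R^-1 `<=` U >] then ball (c p.1) p.2.+1%:R^-1 else set0.
rewrite (_ : U = \bigcup_p F p).
  apply: countable_bigcupT_measurable => // p.
  by rewrite /F; case: ifP => // _; exact: measurable_rV_ball.
apply/seteqP; split=> [x Ux|x [p _]]; last first.
  by rewrite /F; case: ifPn => // /asboolP pU /pU.
have [e /= e0 xeU] : exists2 e : R, 0 < e & ball x e `<=` U.
  by apply/nbhs_ballP; exact: open_nbhs_nbhs.
have [n hn] : exists n, n.+1%:R^-1 < e / 2.
  have e2 : 0 < e / 2 by rewrite divr_gt0.
  have [N _ hN] := near_infty_natSinv_lt (PosNum e2).
  by exists N; exact: (hN N (leqnn N)).
have r0 : 0 < n.+1%:R^-1 :> R by rewrite invr_gt0.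
have /choice[q hq] i : exists q : rat, `|ratr q - x ord0 i| < n.+1%:R^-1.
  have lt : x ord0 i - n.+1%:R^-1 < x ord0 i + n.+1%:R^-1.
    by rewrite ltrBlDr -addrA ltrDl addr_gt0.
  have [q] := rat_in_itvoo lt.
  rewrite in_itv/= => /andP[q1 q2]; exists q.
  by rewrite ltr_distl q1 q2.
pose Q : 'rV[rat]_d := \row_i q i.
have QB y : ball (c Q) n.+1%:R^-1 y <-> forall i, `|ratr (q i) - y ord0 i| < n.+1%:R^-1.
  by rewrite rV_ballE//; split=> h i; have := h i; rewrite !mxE.
exists (Q, n) => //; rewrite /F/= asboolT; first by apply/QB.
move=> y /QB yQ; apply: xeU; apply/rV_ballE => // i.
rewrite (_ : x ord0 i - _ = (ratr (q i) - y ord0 i) - (ratr (q i) - x ord0 i)).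
  by rewrite (le_lt_trans (ler_normB _ _))//; have := yQ i; have := hq i;
     move: hn; move: (n.+1%:R^-1) => r; lra.
ring.
Qed.

Lemma continuous_measurable_rV (f : E -> R) : continuous f ->
  measurable_fun setT f.
Proof.
move=> /continuousP cf; apply: (measurability _ (RGenOpens.measurableE R)).
move=> _ [_ [a [b ->] <-]]; rewrite setTI; apply: open_measurable_rV.
exact/cf/interval_open.
Qed.

Lemma bounded_rV_lty (U : set E) : measurable U -> bounded_set U ->
  (mu U < +oo)%E.
Proof.
move=> mU [B [_ hB]].
have {}hB : forall x, U x -> `|x| <= B + 1 by apply: hB; rewrite ltrDl.
pose A (i : 'I_d) := `[- (B + 1), B + 1]%classic : set R.
apply: (@le_lt_trans _ _ (mu [set v : E | forall i, A i (v ord0 i)])).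
  apply: le_measure; rewrite ?inE//.
    by apply: measurable_box => i; exact: measurable_itv.
  move=> x Ux i; rewrite /A/= in_itv/= -ler_norml.
  exact: le_trans (le_coord_norm x i) (hB _ Ux).
rewrite lebesgue_rV_box; last by move=> i; exact: measurable_itv.
have -> : (\prod_(i < d) lebesgue_measure (A i) =
    (\prod_(i < d) fine (lebesgue_measure (A i)))%:E)%E.
  rewrite -prodEFin; apply: eq_bigr => i _; rewrite fineK// ge0_fin_numE//.
  by rewrite lebesgue_measure_itv/=; case: ifP; rewrite ?ltry// -EFinD ltry.
by rewrite ltry.
Qed.

End borel_rV.

(** * Smooth functions *)

Section smooth_calculus.
Context {R : realType} {d : nat}.
Local Notation E := 'rV[R]_d.
Local Notation e_ i := (delta_mx ord0 i : E).
Implicit Types phi psi : E -> R.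

(** Order-[n] smoothness, with derivatives taken innermost first; this is the
    form in which the product and chain rules can be proved by induction. *)
Fixpoint Cn (n : nat) phi : Prop :=
  if n is m.+1 then [/\ continuous phi, forall i x, derivable phi x (e_ i)
    & forall i, Cn m (partial i phi)] else continuous phi.

Lemma Cn_continuous n phi : Cn n phi -> continuous phi.
Proof. by case: n => [|n] //= []. Qed.

Lemma Cn_partial n phi i : Cn n.+1 phi -> Cn n (partial i phi).
Proof. by move=> /= [_ _]; exact. Qed.

Lemma CnW n phi : Cn n.+1 phi -> Cn n phi.
Proof.
elim: n phi => [|n IH] phi; first by case.
by move=> [cp dp pp]; split => // i; apply: IH; exact: pp.
Qed.

Lemma iter_partial_rcons s i phi :
  iter_partial (rcons s i) phi = iter_partial s (partial i phi).
Proof. by rewrite /iter_partial foldr_rcons. Qed.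

Lemma smoothP phi : smooth phi <-> forall n, Cn n phi.
Proof.
split=> [sp n|].
  elim: n phi sp => [|n IH] phi sp; first by have [] := sp [::].
  have [c0 d0] := sp [::]; split => // i; apply: IH => s.
  by have := sp (rcons s i); rewrite iter_partial_rcons.
move=> + s; elim/last_ind: s phi => [|s i IH] phi cp.
  by split; [exact: (cp 0%N)|have [] := cp 1%N].
by rewrite iter_partial_rcons; apply: IH => n; exact: (Cn_partial i (cp n.+1)).
Qed.

Lemma smooth_continuous phi : smooth phi -> continuous phi.
Proof. by move=> /smoothP/(_ 0%N). Qed.

Lemma smooth_derivable phi i x : smooth phi -> derivable phi x (e_ i).
Proof. by move=> /smoothP/(_ 1%N)[]. Qed.

Lemma smooth_partial i phi : smooth phi -> smooth (partial i phi).
Proof. by move=> /smoothP sp; apply/smoothP => n; exact: Cn_partial. Qed.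

Lemma Cn_cst n (k : R) : Cn n (cst k).
Proof.
elim: n k => [|n IH] k; first exact: cst_continuous.
split; [exact: cst_continuous|by move=> i x; exact: derivable_cst|move=> i].
rewrite (_ : partial i (cst k) = cst 0)//.
by apply/funext => x; rewrite /partial derive_cst.
Qed.

Lemma partialD i phi psi : (forall x, derivable phi x (e_ i)) ->
  (forall x, derivable psi x (e_ i)) ->
  partial i (phi \+ psi) = partial i phi \+ partial i psi.
Proof. by move=> dp dq; apply/funext => x; rewrite /partial deriveD. Qed.

Lemma partialM i phi psi : (forall x, derivable phi x (e_ i)) ->
  (forall x, derivable psi x (e_ i)) ->
  partial i (phi \* psi) = (partial i phi \* psi) \+ (phi \* partial i psi).
Proof.
move=> dp dq; apply/funext => x; rewrite /partial deriveM//=.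
by rewrite addrC; congr (_ + _); rewrite /GRing.scale/= mulrC.
Qed.

Lemma CnD n phi psi : Cn n phi -> Cn n psi -> Cn n (phi \+ psi).
Proof.
elim: n phi psi => [|n IH] phi psi /=.
  by move=> cp cq x; apply: continuousD; [exact: cp|exact: cq].
move=> [cp dp pp] [cq dq pq]; split=> [x|i x|i].
- by apply: continuousD; [exact: cp|exact: cq].
- by apply: derivableD.
- by rewrite partialD//; exact: IH.
Qed.

Lemma CnM n phi psi : Cn n phi -> Cn n psi -> Cn n (phi \* psi).
Proof.
elim: n phi psi => [|n IH] phi psi.
  by move=> /= cp cq x; apply: continuousM; [exact: cp|exact: cq].
move=> Cp Cq; have [cp dp pp] := Cp; have [cq dq pq] := Cq; split=> [x|i x|i].
- by apply: continuousM; [exact: cp|exact: cq].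
- by apply: derivableM.
- rewrite partialM//; apply: CnD.
    exact: (IH _ _ (pp i) (CnW Cq)).
  exact: (IH _ _ (CnW Cp) (pq i)).
Qed.

Lemma smooth_cst (k : R) : smooth (cst k : E -> R).
Proof. by apply/smoothP => n; exact: Cn_cst. Qed.

Lemma smoothD phi psi : smooth phi -> smooth psi -> smooth (phi \+ psi).
Proof. by move=> /smoothP sp /smoothP sq; apply/smoothP => n; exact: CnD. Qed.

Lemma smoothM phi psi : smooth phi -> smooth psi -> smooth (phi \* psi).
Proof. by move=> /smoothP sp /smoothP sq; apply/smoothP => n; exact: CnM. Qed.

Lemma smoothZ k phi : smooth phi -> smooth (k *: phi).
Proof. by move=> sp; exact: (smoothM (smooth_cst k) sp). Qed.

Lemma smooth_partialD i phi psi : smooth phi -> smooth psi ->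
  partial i (phi \+ psi) = partial i phi \+ partial i psi.
Proof. by move=> sp sq; apply: partialD => x; exact: smooth_derivable. Qed.

Lemma smooth_partialM i phi psi : smooth phi -> smooth psi ->
  partial i (phi \* psi) = (partial i phi \* psi) \+ (phi \* partial i psi).
Proof. by move=> sp sq; apply: partialM => x; exact: smooth_derivable. Qed.

Lemma partial_cst i (k : R) : partial i (cst k : E -> R) = cst 0.
Proof. by apply/funext => x; rewrite /partial derive_cst. Qed.

Lemma smooth_partialZ i k phi : smooth phi ->
  partial i (k *: phi) = k *: partial i phi.
Proof.
move=> sp; have := smooth_partialM i (smooth_cst k) sp.
rewrite partial_cst => ->; apply/funext => x /=.
by rewrite mul0r add0r.
Qed.

Lemma is_derive_coord (i j : 'I_d) x : is_derive x (e_ i) (fun v : E => v ord0 j) (i == j)%:R.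
Proof.
have h (t : R) : t != 0 -> t^-1 *: ((fun v : E => v ord0 j) (t *: e_ i + x) - x ord0 j) = (i == j)%:R.
  by move=> t0; rewrite !mxE eqxx addrK/= eq_sym /GRing.scale/= mulrA mulVf// mul1r.
have c : t^-1 *: ((fun v : E => v ord0 j) (t *: e_ i + x) - x ord0 j) @[t --> 0^'] --> ((i == j)%:R : R).
  apply: cvg_near_cst; near=> t; apply: h; near: t; exact: nbhs_dnbhs_neq.
split; first by apply/cvg_ex; eexists; exact: c.
exact: cvg_lim c.
Unshelve. all: by end_near. Qed.

Lemma partial_coord i j : partial i (fun v : E => v ord0 j) = cst (i == j)%:R.
Proof. by apply/funext => x; have [_] := is_derive_coord i j x. Qed.

Lemma smooth_coord j : smooth (fun v : E => v ord0 j).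
Proof.
apply/smoothP => -[|n]; first exact: coord_continuous.
split; [exact: coord_continuous|by move=> i x; have [] := is_derive_coord i j x|].
by move=> i; rewrite partial_coord; exact: Cn_cst.
Qed.

(** Directional derivatives are derivatives along a line; this is how the
    one-dimensional chain rule applies to them. *)
Lemma derive_line (V : normedModType R) (f : V -> R) x v :
  'D_v f x = derive1 (fun t : R => f (t *: v + x)) 0.
Proof.
rewrite derive1E /derive; congr (lim (_ @ 0^')); apply/funext => t /=.
by rewrite addr0 scale0r add0r [t *: 1]mulr1.
Qed.

Lemma is_derive_comp1 (h : R -> R) phi x v (dh : R) : derivable phi x v ->
  is_derive (phi x) 1 h dh -> is_derive x v (h \o phi) (dh * 'D_v phi x).
Proof.
move=> dphi [dhx hE]; pose g (t : R) := phi (t *: v + x).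
have g0 : g 0 = phi x by rewrite /g scale0r add0r.
have dg : derivable g 0 1 by exact: (derivable1P _ _ _).1 dphi.
have dhg : derivable h (g 0) 1 by rewrite g0.
have dcg : derivable (h \o g) 0 1.
  by apply/derivable1_diffP; apply: differentiable_comp; exact/derivable1_diffP.
split; first exact: (derivable1P (h \o phi) x v).2 dcg.
have E : (fun t : R => (h \o phi) (t *: v + x)) = h \o g by [].
rewrite derive_line E (derive1_comp dg dhg) g0 derive1E hE.
by rewrite (derive_line phi).
Qed.

End smooth_calculus.

(** * A smooth approximation of the positive part *)

Section smooth_positive_part.
Context {R : realType}.
Variable e : R.
Hypothesis e0 : 0 < e.
Implicit Types t q : R.

Definition hypot t := Num.sqrt (e ^+ 2 + t ^+ 2).

(** The positive part is [(|t| + t) / 2], and [hypot - e] smooths [|t|] while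
    keeping the value 0 at 0. *)
Definition smooth_pos t := 2^-1 * (hypot t - e + t).

Definition dsmooth_pos t := 2^-1 * (1 + t * (hypot t)^-1).

Lemma hypot_arg_gt0 t : 0 < e ^+ 2 + t ^+ 2.
Proof. by rewrite ltr_pwDl ?sqr_ge0// exprn_gt0. Qed.

Lemma hypot_gt0 t : 0 < hypot t.
Proof. by rewrite sqrtr_gt0 hypot_arg_gt0. Qed.

Lemma hypot_sq t : hypot t ^+ 2 = e ^+ 2 + t ^+ 2.
Proof. by rewrite sqr_sqrtr// ltW// hypot_arg_gt0. Qed.

Lemma norm_le_hypot t : `|t| <= hypot t.
Proof.
rewrite -sqrtr_sqr ler_sqrt; last exact/ltW/hypot_arg_gt0.
by rewrite lerDr sqr_ge0.
Qed.

Lemma hypot_le t : hypot t <= e + `|t|.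
Proof.
have -> : e + `|t| = Num.sqrt ((e + `|t|) ^+ 2).
  by rewrite sqrtr_sqr [RHS]ger0_norm// addr_ge0// ltW.
rewrite ler_sqrt ?sqr_ge0//.
rewrite sqrrD real_normK ?num_real// -addrA lerD2l lerDr.
by rewrite mulrn_wge0// mulr_ge0// ltW.
Qed.

Lemma is_derive_hypot t : is_derive t 1 hypot (t * (hypot t)^-1).
Proof.
pose w s := e ^+ 2 + s ^+ 2.
have dw : is_derive t 1 w (2 * t).
  rewrite /w; apply: is_derive_eq.
  by rewrite add0r /GRing.scale/= ?expr1; ring.
have ds := is_derive1_sqrt (hypot_arg_gt0 t).
have dwt : derivable w t 1 by case: dw.
have dst : derivable Num.sqrt (w t) 1 by case: ds.
have := derive1_comp dwt dst; rewrite !derive1E.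
have [_ ->] := ds; have [_ ->] := dw => dE; split.
  apply/derivable1_diffP; apply: (@differentiable_comp _ _ _ _ w Num.sqrt); exact/derivable1_diffP.
rewrite -[LHS]/('D_1 (Num.sqrt \o w) t) dE -/(hypot t).
by field; rewrite gt_eqF// hypot_gt0.
Qed.

Lemma is_derive_hypotV t :
  is_derive t 1 (fun s => (hypot s)^-1) (- (t * (hypot t)^-1 ^+ 3)).
Proof.
have [dh hE] := is_derive_hypot t; have h0 : hypot t != 0 by rewrite gt_eqF// hypot_gt0.
split; first exact: derivableV.
by rewrite deriveV// hE /GRing.scale/=; field.
Qed.

Lemma is_derive_smooth_pos t : is_derive t 1 smooth_pos (dsmooth_pos t).
Proof.
have dh := is_derive_hypot t; rewrite /smooth_pos.
by apply: is_derive_eq; rewrite /dsmooth_pos /GRing.scale/= subr0 addrC.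
Qed.

Lemma ratio_hypot t : `|t * (hypot t)^-1| <= 1.
Proof.
rewrite normrM normfV (ger0_norm (ltW (hypot_gt0 t))).
by rewrite ler_pdivrMr ?hypot_gt0// mul1r norm_le_hypot.
Qed.

Lemma dsmooth_pos_itv t : 0 <= dsmooth_pos t <= 1.
Proof. by have := ratio_hypot t; rewrite ler_norml /dsmooth_pos => /andP[]; lra. Qed.

Lemma smooth_pos_approx t : `|smooth_pos t - Num.max t 0| <= e.
Proof.
have h1 := norm_le_hypot t; have h2 := hypot_le t; rewrite /smooth_pos ler_norml.
have [t0|t0] := leP t 0.
  by rewrite ler0_norm// in h1 h2; apply/andP; split; lra.
by rewrite gtr0_norm// in h1 h2; apply/andP; split; lra.
Qed.

Lemma smooth_pos_opp q : 0 <= q -> `|smooth_pos (- q)| <= e.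
Proof.
move=> q0; have := smooth_pos_approx (- q).
by rewrite max_r ?subr0// oppr_le0.
Qed.

(** At a negative argument of size [q] the slope is [O(e / q)], so that it stays
    small after multiplication by anything that is controlled by [q]. *)
Lemma dsmooth_pos_opp q : 0 <= q -> `|dsmooth_pos (- q) * q| <= e.
Proof.
move=> q0; have /andP[d0 d1] := dsmooth_pos_itv (- q).
rewrite ger0_norm; last exact: mulr_ge0.
have h1 := norm_le_hypot (- q); have h2 := hypot_le (- q).
rewrite normrN ger0_norm// in h1 h2.
have h0 := hypot_gt0 (- q).
have -> : dsmooth_pos (- q) * q = 2^-1 * (q / hypot (- q)) * (hypot (- q) - q).
  by rewrite /dsmooth_pos; field; rewrite gt_eqF.
have r1 : q / hypot (- q) <= 1 by rewrite ler_pdivrMr// mul1r.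
have r0 : 0 <= q / hypot (- q) by rewrite divr_ge0// ltW.
by move: (q / hypot (- q)) r0 r1 => r; nra.
Qed.

End smooth_positive_part.

Section smooth_positive_part_rV.
Context {R : realType} {d : nat}.
Local Notation E := 'rV[R]_d.
Implicit Types phi psi : E -> R.
Variable e : R.
Hypothesis e0 : 0 < e.

(** The derivative of [1 / hypot] is a product of [1 / hypot] with itself and
    with the argument, so smoothness bootstraps through the product rule. *)
Lemma Cn_hypotV n phi : Cn n phi -> Cn n (fun x => (hypot e (phi x))^-1).
Proof.
elim: n phi => [|n IH] phi Cp; have cp := Cn_continuous Cp.
  move=> x; apply: (@continuous_comp _ _ _ phi (fun t => (hypot e t)^-1)).
    exact: cp.
  apply/differentiable_continuous/derivable1_diffP.
  by have [] := is_derive_hypotV e0 (phi x).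
have [_ dp pp] := Cp.
have dc i x := is_derive_comp1 (dp i x) (is_derive_hypotV e0 (phi x)).
split=> [x|i x|i].
- apply: (@continuous_comp _ _ _ phi (fun t => (hypot e t)^-1)); first exact: cp.
  apply/differentiable_continuous/derivable1_diffP.
  by have [] := is_derive_hypotV e0 (phi x).
- by have [] := dc i x.
- have C0 := IH _ (CnW Cp).
  (* Minus phi times the cube of 1 / hypot times the derivative of phi. *)
  rewrite (_ : partial i _ = cst (-1) \* (phi \* ((fun x => (hypot e (phi x))^-1) \*
      ((fun x => (hypot e (phi x))^-1) \* ((fun x => (hypot e (phi x))^-1) \* partial i phi)))));
    first by do ![apply: CnM => //]; [exact: Cn_cst|exact: CnW|exact: pp].
  apply/funext => x; have [_ dE] := dc i x; rewrite /partial dE/= -/(partial i phi x).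
  ring.
Qed.

Lemma smooth_hypotV phi : smooth phi -> smooth (fun x => (hypot e (phi x))^-1).
Proof. by move=> /smoothP sp; apply/smoothP => n; exact: Cn_hypotV. Qed.

Lemma smooth_smooth_pos phi : smooth phi -> smooth (smooth_pos e \o phi).
Proof.
move=> sp;
(* hypot itself is 1 / hypot times the square of hypot. *)
rewrite (_ : _ \o _ = cst 2^-1 \*
    (((fun x => (hypot e (phi x))^-1) \* (cst (e ^+ 2) \+ phi \* phi)) \+ (cst (- e) \+ phi))).
  apply: smoothM; first exact: smooth_cst.
  apply: smoothD; last by apply: smoothD => //; exact: smooth_cst.
  apply: smoothM; first exact: smooth_hypotV.
  by apply: smoothD; [exact: smooth_cst|exact: smoothM].
apply/funext => x /=; rewrite /smooth_pos -expr2 -hypot_sq//.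
by field; rewrite gt_eqF// hypot_gt0.
Qed.

Lemma partial_smooth_pos i phi x : smooth phi ->
  partial i (smooth_pos e \o phi) x = dsmooth_pos e (phi x) * partial i phi x.
Proof.
move=> sp; have dp : derivable phi x (delta_mx ord0 i) by exact: smooth_derivable.
by have [_] := is_derive_comp1 dp (is_derive_smooth_pos e0 (phi x)).
Qed.

End smooth_positive_part_rV.

(** * The divergence theorem for compact supports *)

Section divergence.
Context {R : realType}.
Local Notation leb := (@lebesgue_measure R).

Lemma rV_norm_le d (x : 'rV[R]_d) M : 0 <= M ->
  (forall i, `|x ord0 i| <= M) -> `|x| <= M.
Proof.
move=> M0 h; rewrite [leLHS]mx_normrE; apply: bigmax_le => // -[i j] _ /=.
by rewrite ord1; exact: h.
Qed.

Lemma le_rV_cons_l d (p : R * 'rV[R]_d) : `|p.1| <= `|rV_cons p|.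
Proof. by have := le_coord_norm (rV_cons p) ord0; rewrite rV_cons0. Qed.

Lemma le_rV_cons_r d (p : R * 'rV[R]_d) : `|p.2| <= `|rV_cons p|.
Proof.
apply: rV_norm_le => // i.
by have := le_coord_norm (rV_cons p) (lift ord0 i); rewrite rV_consS.
Qed.

Lemma rV_cons_ball d (p q : R * 'rV[R]_d) e : 0 < e ->
  `|p.1 - q.1| < e -> ball p.2 e q.2 -> ball (rV_cons p) e (rV_cons q).
Proof.
move=> e0 h1 /(rV_ballE _ _ e0) h2; apply/rV_ballE => // i.
by case: (unliftP ord0 i) => [j|] ->; rewrite ?rV_cons0 ?rV_consS.
Qed.

Lemma continuous_rV_cons_r d (x : R) : continuous (fun v : 'rV[R]_d => rV_cons (x, v)).
Proof.
move=> v A /nbhs_ballP[e /= e0 eA]; apply/nbhs_ballP; exists e => //= w vw.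
by apply: eA; apply: rV_cons_ball => //=; rewrite subrr normr0.
Qed.

Lemma continuous_rV_cons_l d (v : 'rV[R]_d) : continuous (fun x : R => rV_cons (x, v)).
Proof.
move=> x A /nbhs_ballP[e /= e0 eA]; apply/nbhs_ballP; exists e => //= w xw.
by apply: eA; apply: rV_cons_ball => //=; exact: ballxx.
Qed.

Lemma rV_cons_shift0 d (t x : R) (v : 'rV[R]_d) :
  t *: delta_mx ord0 ord0 + rV_cons (x, v) = rV_cons (t * 1 + x, v).
Proof.
apply/rowP => i; rewrite !mxE eqxx/=; case: (unliftP ord0 i) => [j|] ->.
  by rewrite /= mulr0 add0r.
by [].
Qed.

Lemma rV_cons_shiftS d (t x : R) (v : 'rV[R]_d) i :
  t *: delta_mx ord0 (lift ord0 i) + rV_cons (x, v) =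
  rV_cons (x, t *: delta_mx ord0 i + v).
Proof.
apply/rowP => j; rewrite !mxE eqxx/=; case: (unliftP ord0 j) => [k|] ->.
  by rewrite /= !mxE eqxx/= (inj_eq lift_inj).
by rewrite /= mulr0 add0r.
Qed.

Lemma slice_r d (phi : 'rV[R]_d.+1 -> R) i x v : 
  derivable phi (rV_cons (x, v)) (delta_mx ord0 (lift ord0 i)) ->
  derivable (fun w => phi (rV_cons (x, w))) v (delta_mx ord0 i) /\
  partial i (fun w => phi (rV_cons (x, w))) v = partial (lift ord0 i) phi (rV_cons (x, v)).
Proof.
have E : (fun t : R => phi (t *: delta_mx ord0 (lift ord0 i) + rV_cons (x, v))) =
         (fun t => phi (rV_cons (x, t *: delta_mx ord0 i + v))).
  by apply/funext => t; rewrite rV_cons_shiftS.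
move=> /derivable1P; rewrite E => h; split; first exact/derivable1P.
by rewrite /partial !derive_line E.
Qed.

Lemma slice_l d (phi : 'rV[R]_d.+1 -> R) x v :
  derivable phi (rV_cons (x, v)) (delta_mx ord0 ord0) ->
  is_derive x 1 (fun t => phi (rV_cons (t, v))) (partial ord0 phi (rV_cons (x, v))).
Proof.
have E : (fun t : R => phi (t *: delta_mx ord0 ord0 + rV_cons (x, v))) =
         (fun t => phi (rV_cons (t *: 1 + x, v))).
  by apply/funext => t; rewrite rV_cons_shift0.
move=> /derivable1P; rewrite E => h; split; first exact/derivable1P.
by rewrite /partial !derive_line E.
Qed.

Lemma partial_eq0 d (phi : 'rV[R]_d -> R) i x : (\near x, phi x = 0) -> partial i phi x = 0.
Proof.
by move=> h; rewrite /partial (near_eq_derive _ (h : \near x, phi x = cst 0 x)) derive_cst.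
Qed.

Lemma open_norm_gt (V : normedModType R) L : open [set y : V | L < `|y|].
Proof.
apply: (@open_comp _ _ (fun y : V => `|y|) [set t | L < t]).
  by move=> y _; exact: norm_continuous.
exact: open_gt.
Qed.

Lemma closed_norm_le (V : normedModType R) L : closed [set y : V | `|y| <= L].
Proof.
rewrite (_ : [set _ | _] = ~` [set y : V | L < `|y|]).
  exact/open_closedC/open_norm_gt.
by apply/seteqP; split=> y /=; rewrite leNgt => /negP.
Qed.

Lemma near_norm_gt d (x : 'rV[R]_d) L : L < `|x| -> \forall y \near x, L < `|y|.
Proof.
by move=> Lx; exact: (open_nbhs_nbhs (conj (@open_norm_gt _ L) Lx)).
Qed.

Section one_function.
Variables (d : nat) (phi : 'rV[R]_d -> R) (i : 'I_d) (L : R).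
Hypotheses (cdp : continuous (partial i phi))
  (sp : forall x, L < `|x| -> phi x = 0).

Lemma partial_out x : L < `|x| -> partial i phi x = 0.
Proof.
by move=> Lx; apply: partial_eq0; apply: filterS (near_norm_gt Lx) => y /sp.
Qed.

Lemma bounded_of_norm_le (f : 'rV[R]_d -> R) : continuous f ->
  (forall x, L < `|x| -> f x = 0) -> exists C, forall x, `|f x| <= C.
Proof.
move=> cf fL; have cB : compact [set x : 'rV[R]_d | `|x| <= L].
  apply: bounded_closed_compact.
    by exists L; split; [exact: num_real|move=> M LM x /= /le_trans; apply; exact: ltW].
  exact: closed_norm_le.
have := continuous_compact (continuous_subspaceT cf) cB.
move=> /compact_bounded[C [_ hC]]; exists (Num.max (C + 1) 0) => x.
have [xL|/fL->] := leP `|x| L; last by rewrite normr0 le_max lexx orbT.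
by rewrite le_max (hC (C + 1)) ?ltrDl//; exists x.
Qed.

Lemma integrable_of_norm_le (f : 'rV[R]_d -> R) : continuous f ->
  (forall x, L < `|x| -> f x = 0) ->
  (@lebesgue_rV R d).-integrable setT (EFin \o f).
Proof.
move=> cf fL; have [C hC] := bounded_of_norm_le cf fL.
pose B := [set x : 'rV[R]_d | `|x| <= L].
have mB : measurable B.
  rewrite -[B]setCK; apply: measurableC; apply: open_measurable_rV.
  exact/closed_openC/closed_norm_le.
rewrite (_ : f = f \_ B); last first.
  apply/funext => x; rewrite patchE; case: ifPn => // /negP xB.
  by apply: fL; rewrite ltNge; apply/negP => xL; apply: xB; rewrite inE.
rewrite -restrict_EFin; apply/integrable_restrict => //; rewrite setTI.
apply: measurable_bounded_integrable => //.
- apply: bounded_rV_lty => //.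
  by exists L; split; [exact: num_real|move=> M LM x /= /le_trans; apply; exact: ltW].
- by apply: measurable_funTS; exact: continuous_measurable_rV.
- by exists C; split; [exact: num_real|move=> M CM x _; exact: le_trans (hC x) (ltW CM)].
Qed.

End one_function.

Lemma FTC_compact (g g' : R -> R) (L : R) : (forall x : R, is_derive x 1 g (g' x)) ->
  continuous g' -> (forall x, L < `|x| -> g x = 0) ->
  (\int[leb]_x (g' x)%:E = 0)%E.
Proof.
move=> dg cg gL; pose K := `|L| + 1.
have LK : L < K by rewrite (le_lt_trans (ler_norm _))// ltrDl.
have K0 : 0 < K by rewrite ltr_wpDl.
have g'0 x : L < `|x| -> g' x = 0.
  move=> Lx; have [_ <-] := dg x.
  have oL := @open_norm_gt R^o L.
  have nL : \near x, g x = cst 0 x.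
    by apply: filterS (open_nbhs_nbhs (conj oL Lx)) => y /gL.
  by rewrite (near_eq_derive _ nL) derive_cst.
have -> : (\int[leb]_x (g' x)%:E = \int[leb]_(x in `[(- K)%R, K]) (g' x)%:E)%E.
  rewrite [RHS]integral_mkcond; apply: eq_integral => x _.
  rewrite patchE; case: ifPn => // /negP xK; rewrite g'0//.
  rewrite ltNge; apply/negP => xL; apply: xK; rewrite inE/= in_itv/= -ler_norml.
  exact: le_trans xL (ltW LK).
have cgx x : {for x, continuous g}.
  by apply: differentiable_continuous; apply/derivable1_diffP; have [] := dg x.
rewrite (@continuous_FTC2 _ g' g)//.
- have -> : g K = 0 by apply: gL; rewrite gtr0_norm.
  have -> : g (- K) = 0 by apply: gL; rewrite normrN gtr0_norm.
  by rewrite subee.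
- by rewrite gtrN.
- by apply: continuous_subspaceT.
- split; first by move=> x _; have [] := dg x.
  + exact: cvg_at_right_filter (cgx _).
  + exact: cvg_at_left_filter (cgx _).
- by move=> x _; rewrite derive1E; have [] := dg x.
Qed.

Section slicing.
Variables (d : nat) (m : {measure set (measurableTypeR R * 'rV[R]_d) -> \bar R}).
Let mcons : measurable_fun setT (@rV_cons R d : measurableTypeR R * 'rV[R]_d -> _) :=
  @measurable_rV_cons R d.
Hypothesis mE : forall A, @lebesgue_rV R d.+1 A = pushforward m (@rV_cons R d) A.
Variable f : 'rV[R]_d.+1 -> \bar R.
Hypothesis mf : measurable_fun setT f.

Lemma ge0_integral_slice : (forall x, 0 <= f x)%E ->
  (\int[@lebesgue_rV R d.+1]_x f x = \int[m]_z (f \o @rV_cons R d) z)%E.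
Proof.
move=> f0; rewrite -[in RHS](preimage_setT (@rV_cons R d)).
rewrite -(ge0_integral_pushforward mcons m measurableT mf) //.
by apply: eq_measure_integral => A mA _; exact: mE.
Qed.

Lemma integral_slice : m.-integrable setT (f \o @rV_cons R d) ->
  (\int[@lebesgue_rV R d.+1]_x f x = \int[m]_z (f \o @rV_cons R d) z)%E.
Proof.
move=> fi; rewrite -[in RHS](preimage_setT (@rV_cons R d)).
rewrite -(integral_pushforward mcons mf fi measurableT).
by apply: eq_measure_integral => A mA _; exact: mE.
Qed.

End slicing.

(** The divergence theorem for compactly supported fields.  Lebesgue measure is
    sliced along the first coordinate: in the direction of that coordinate the
    claim is the fundamental theorem of calculus on each line, and in any other
    direction it is the claim for the slices, one dimension below. *)
Lemma integral_partial0 d (phi : 'rV[R]_d -> R) (i : 'I_d) (L : R) :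
  continuous phi -> (forall x, derivable phi x (delta_mx ord0 i)) ->
  continuous (partial i phi) -> (forall x, L < `|x| -> phi x = 0) ->
  (\int[@lebesgue_rV R d]_x (partial i phi x)%:E = 0)%E.
Proof.
elim: d phi i => [|d IH] phi i cp dp cdp pL; first by have [] := i.
have po x : L < `|x| -> partial i phi x = 0 by exact: partial_out.
have ip := integrable_of_norm_le cdp po.
have mE' A : @lebesgue_rV R d.+1 A =
  pushforward [the {measure set _ -> \bar R} of leb \x @lebesgue_rV R d]%E (@rV_cons R d) A.
  by [].
pose f := (EFin \o partial i phi) \o @rV_cons R d.
have mE : measurable_fun setT (EFin \o partial i phi).
  by apply/measurable_EFinP; exact: continuous_measurable_rV.
have mf : measurable_fun setT f.
  by apply: measurableT_comp => //; exact: measurable_rV_cons.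
have fint : (leb \x @lebesgue_rV R d)%E.-integrable setT f.
  apply/integrableP; split => //.
  move/integrableP : ip => [_]; rewrite (ge0_integral_slice mE')//.
  exact: measurableT_comp.
transitivity (\int[leb \x @lebesgue_rV R d]_z f z)%E.
  exact: (integral_slice mE').
case: (unliftP ord0 i) => [j|] ij.
  rewrite -integral12_prod_meas1//; apply: integral0_eq => x _ /=.
  rewrite /fubini_F /f /= ij.
  have sl v := slice_r (v := v) (x := x) (i := j) (phi := phi).
  rewrite -[RHS](IH (fun w => phi (rV_cons (x, w))) j).
  - by apply: eq_integral => v _; rewrite (sl v _).2// -ij.
  - move=> v; apply: continuous_comp; [exact: continuous_rV_cons_r|exact: cp].
  - by move=> v; apply: (sl v _).1; rewrite -ij.
  - rewrite (_ : partial j _ = partial i phi \o (fun w => rV_cons (x, w))).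
      by move=> v; apply: continuous_comp; [exact: continuous_rV_cons_r|exact: cdp].
    by apply/funext => v; rewrite (sl v _).2 -ij.
  - by move=> v Lv; apply: pL; exact: lt_le_trans Lv (le_rV_cons_r (x, v)).
rewrite -integral21_prod_meas1//; apply: integral0_eq => v _ /=.
rewrite /fubini_G /f /=.
apply: (@FTC_compact (fun x => phi (rV_cons (x, v))) _ L).
- by move=> x; rewrite ij; apply: slice_l; rewrite -ij.
- by move=> x; apply: continuous_comp; [exact: continuous_rV_cons_l|exact: cdp].
- by move=> x Lx; apply: pL; exact: lt_le_trans Lx (le_rV_cons_l (x, v)).
Qed.

End divergence.

(** * Test functions *)

Section test_functions.
Context {R : realType} {d : nat}.
Local Notation E := 'rV[R]_d.
Local Notation mu := (@lebesgue_rV R d).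
Variable Om : set E.
Implicit Types phi psi chi : E -> R.

Lemma supp_notin phi x : ~ supp phi x -> phi x = 0.
Proof.
move=> sx; apply: contrapT => /eqP px; apply: sx.
exact: subset_closure.
Qed.

Lemma test_notin phi x : test_function Om phi -> ~ Om x -> phi x = 0.
Proof. by move=> [_ _ sO] Ox; apply: supp_notin => /sO. Qed.

Lemma test_smooth phi : test_function Om phi -> smooth phi.
Proof. by case. Qed.

Lemma test_of_smooth phi chi : test_function Om phi -> smooth chi ->
  (forall x, phi x = 0 -> chi x = 0) -> test_function Om chi.
Proof.
move=> [sp cp pO] sc pc.
have sub : supp chi `<=` supp phi.
  by apply: closureS => x /=; apply: contra => /eqP/pc ->.
split => //; last exact: subset_trans sub pO.
by apply: subclosed_compact cp sub; exact: closed_closure.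
Qed.

Lemma testD phi psi : test_function Om phi -> test_function Om psi ->
  test_function Om (phi \+ psi).
Proof.
move=> [sp cp pO] [sq cq qO].
have sub : supp (phi \+ psi) `<=` supp phi `|` supp psi.
  have cU : closed (supp phi `|` supp psi) by apply: closedU; exact: closed_closure.
  rewrite ((closure_id _).1 cU); apply: closureS => x /= pq.
  have [p0|p0] := eqVneq (phi x) 0; last by left; exact: subset_closure.
  by right; apply: subset_closure; move: pq; rewrite /= p0 add0r.
split; first exact: smoothD.
  by apply: subclosed_compact (compactU cp cq) sub; exact: closed_closure.
by move=> x /sub[/pO|/qO].
Qed.

Lemma testZ k phi : test_function Om phi -> test_function Om (k *: phi).
Proof.
move=> tp; apply: (test_of_smooth tp); first exact/smoothZ/test_smooth.
by move=> x p0; rewrite -[LHS]/(k * phi x) p0 mulr0.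
Qed.

Lemma testM phi psi : smooth phi -> test_function Om psi ->
  test_function Om (phi \* psi).
Proof.
move=> sp tp; apply: (test_of_smooth tp); first exact: smoothM sp (test_smooth tp).
by move=> x p0 /=; rewrite p0 mulr0.
Qed.

Lemma test0 : test_function Om (0 : E -> R).
Proof.
have s0 : supp (0 : E -> R) = set0.
  rewrite /supp (_ : [set _ | _] = set0) ?closure0//.
  by apply/seteqP; split=> x //=; rewrite eqxx.
by split; [exact: (smooth_cst 0)|rewrite s0; exact: compact0|rewrite s0].
Qed.

Lemma test_partial i phi : test_function Om phi -> test_function Om (partial i phi).
Proof.
move=> [sp cp pO].
have sub : supp (partial i phi) `<=` supp phi.
  have cS : closed (supp phi) by exact: closed_closure.
  rewrite ((closure_id _).1 cS); apply: closureS => x /= px.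
  apply: contrapT => sx; move: px => /eqP; apply.
  apply: partial_eq0; have oS : open (~` supp phi) by exact/closed_openC/closed_closure.
  by apply: filterS (open_nbhs_nbhs (conj oS sx)) => y; exact: supp_notin.
split; first exact: smooth_partial.
  by apply: subclosed_compact cp sub; exact: closed_closure.
exact: subset_trans sub pO.
Qed.

Lemma test_norm_le phi : test_function Om phi ->
  exists L, forall x, L < `|x| -> phi x = 0.
Proof.
move=> [sp /compact_bounded[M [_ hM]] _]; exists (M + 1) => x Mx.
apply: supp_notin => sx; have M1 : M < M + 1 by rewrite ltrDl.
by have := hM _ M1 _ sx; rewrite /= leNgt Mx.
Qed.

Lemma test_bounded phi : test_function Om phi -> exists C, forall x, `|phi x| <= C.
Proof.
move=> tp; have [L hL] := test_norm_le tp.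
exact: bounded_of_norm_le (smooth_continuous (test_smooth tp)) hL.
Qed.

Lemma test_integral_partial phi i : test_function Om phi ->
  \int[mu]_(x in Om) partial i phi x = 0.
Proof.
move=> tp; have sp := test_smooth tp; have [L hL] := test_norm_le tp.
rewrite Rintegral_mkcond (_ : _ \_ _ = partial i phi); last first.
  apply/funext => x; rewrite patchE; case: ifPn => // /negP xO.
  by rewrite (test_notin (test_partial i tp))// => Ox; apply: xO; rewrite inE.
rewrite /Rintegral (@integral_partial0 _ _ phi i L)//.
- exact: smooth_continuous.
- by move=> x; exact: smooth_derivable.
- exact/smooth_continuous/smooth_partial.
Qed.

Hypotheses (oO : open Om) (bO : bounded_set Om).

Let mOm := open_measurable_rV oO.
Let finOm := bounded_rV_lty mOm bO.
Local Hint Resolve mOm finOm : core.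

Lemma continuous_measurable_Om phi : continuous phi -> measurable_fun Om phi.
Proof. by move=> cp; apply: measurable_funTS; exact: continuous_measurable_rV. Qed.

Lemma test_sqint phi : test_function Om phi -> sqint mu Om phi.
Proof.
move=> tp; have [C hC] := test_bounded tp.
apply: (@sqint_bounded _ _ _ _ _ _ _ phi C) => //.
by apply: continuous_measurable_Om; exact: smooth_continuous (test_smooth tp).
Qed.

(** Continuous functions are bounded on the closed ball that contains [Om]. *)
Lemma continuous_sqint phi : continuous phi -> sqint mu Om phi.
Proof.
move=> cp; have [B [_ hB]] := bO.
have cB : compact [set x : E | `|x| <= B + 1].
  apply: bounded_closed_compact; last exact: closed_norm_le.
  by exists (B + 1); split; [exact: num_real|move=> M LM x /= /le_trans; apply; exact: ltW].
have := continuous_compact (continuous_subspaceT cp) cB.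
move=> /compact_bounded[C [_ hC]].
apply: (@sqint_bounded _ _ _ _ _ _ _ phi (C + 1)) => //.
  exact: continuous_measurable_Om.
move=> x Ox; apply: (hC (C + 1)); first by rewrite ltrDl.
by exists x => //=; apply: (hB (B + 1)) => //; rewrite ltrDl.
Qed.

Lemma smooth_sqint phi : smooth phi -> sqint mu Om phi.
Proof. by move=> /smooth_continuous; exact: continuous_sqint. Qed.

Lemma integration_by_parts_test phi psi i : smooth phi -> test_function Om psi ->
  ip mu Om phi (partial i psi) = - ip mu Om (partial i phi) psi.
Proof.
move=> sp tp; have sq := test_smooth tp.
have := test_integral_partial i (testM sp tp).
(* The derivative of the product integrates to zero. *)
rewrite smooth_partialM// RintegralD//.
- by rewrite !ipE; lra.
- apply: integM => //; [exact/smooth_sqint/smooth_partial|exact: smooth_sqint].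
- apply: integM => //; [exact: smooth_sqint|exact/smooth_sqint/smooth_partial].
Qed.

End test_functions.

(** * The space of functions that vanish on the boundary *)

Section sobolev_bridge.
Context {R : realType} {d : nat}.
Local Notation E := 'rV[R]_d.
Local Notation mu := (@lebesgue_rV R d).
Variable Om : set E.
Hypotheses (oO : open Om) (bO : bounded_set Om).
Implicit Types (u v : E -> R) (Du Dv : E -> E).
Local Notation sq := (sqint mu Om).
Local Notation ip := (ip mu Om).
Local Notation nrm2 f := (ip f f).
Let mOm := open_measurable_rV oO.
Let finOm := bounded_rV_lty mOm bO.
Local Hint Resolve mOm finOm : core.

Lemma integral_restrict_sq u :
  (\int[mu]_x `|(EFin \o u \_ Om) x| `^ 2 = \int[mu]_(x in Om) ((u x) ^+ 2)%:E)%E.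
Proof.
rewrite [RHS]integral_mkcond; apply: eq_integral => x _.
rewrite /= !patchE; case: ifPn => _.
  by rewrite ?poweR_EFin powR_mulrn// real_normK// num_real.
by rewrite normr0 ?poweR_EFin powR_mulrn// expr0n.
Qed.

Lemma L2P u : L2 Om u <-> sq u.
Proof.
rewrite /L2 inE; split.
  move=> lu; have := Lfun2_integrable_sqr lu.
  move: lu => /andP[]; rewrite !inE/= => mu2 _.
  move=> /integrableP[_ fin]; have mu' : measurable_fun Om u by apply/measurable_restrictT.
  split => //; apply/integrableP; split.
    by apply: measurable_EFin; exact: measurable_funX.
  move: fin; rewrite [in X in (X < _)%E -> _](_ : (\int[mu]_x _)%E =
    (\int[mu]_(x in Om) `|((u x) ^+ 2)%:E|)%E)//.
  rewrite [RHS]integral_mkcond; apply: eq_integral => x _.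
  by rewrite /= !patchE; case: ifPn => _; rewrite ?expr0n ?normr0.
move=> [mu' iu]; apply/andP; split; rewrite inE/=; first by move: mu' => /(measurable_restrictT u mOm).
rewrite /finite_norm unlock integral_restrict_sq poweR12_sqrt; last first.
  by apply: integral_ge0 => x _; rewrite lee_fin sqr_ge0.
by rewrite ip_EFin//= ltry.
Qed.

Lemma L2normE u : sq u -> L2norm Om u = (Num.sqrt (nrm2 u))%:E.
Proof.
move=> su; rewrite /L2norm unlock integral_restrict_sq poweR12_sqrt ?ip_EFin//.
by rewrite lee_fin ipff_ge0.
Qed.

(** The closure of the test functions in [H^1] norm, phrased with real squared
    norms.  That the second component is the weak gradient of the first is a
    consequence, because integration by parts passes to the limit. *)
Definition H10 u Du := [/\ sq u, forall i, sq (fun x => Du x ord0 i) &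
  forall e : R, 0 < e -> exists phi, [/\ test_function Om phi,
    nrm2 (fun x => phi x - u x) <= e &
    forall i, nrm2 (fun x => partial i phi x - Du x ord0 i) <= e]].

Lemma H10_sq u Du : H10 u Du -> sq u. Proof. by case. Qed.
Lemma H10_sqD u Du i : H10 u Du -> sq (fun x => Du x ord0 i). Proof. by case. Qed.

Lemma nrm2_near f g h : sq f -> sq g -> sq h ->
  nrm2 (fun x => f x - h x) <=
  2 * (nrm2 (fun x => f x - g x) + nrm2 (fun x => g x - h x)).
Proof.
move=> sf sg sh; rewrite (_ : nrm2 (fun x => f x - h x) =
    nrm2 (fun x => (f x - g x) + (g x - h x))).
  by apply: ip_sqD => //; exact: sqintB.
by apply: eq_ip => x _; rewrite subrKA.
Qed.

Lemma H10_closed u Du : sq u -> (forall i, sq (fun x => Du x ord0 i)) ->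
  (forall e : R, 0 < e -> exists v Dv, [/\ H10 v Dv,
    nrm2 (fun x => v x - u x) <= e &
    forall i, nrm2 (fun x => Dv x ord0 i - Du x ord0 i) <= e]) ->
  H10 u Du.
Proof.
move=> su sDu h; split => // e e0; have e4 : 0 < e / 4 by rewrite divr_gt0.
have [v [Dv [[sv sDv hv] vu Dvu]]] := h _ e4.
have [phi [tp pv pDv]] := hv _ e4; have sp := test_smooth tp.
exists phi; split => // [|i].
  apply: le_trans (@nrm2_near _ v _ _ _ _) _ => //; first exact: smooth_sqint.
  by move: pv vu; lra.
apply: le_trans (@nrm2_near _ (fun x => Dv x ord0 i) _ _ _ _) _ => //.
  exact/smooth_sqint/smooth_partial.
by move: (pDv i) (Dvu i); lra.
Qed.

Definition grad (phi : E -> R) : E -> E := fun x => \row_i partial i phi x.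

Lemma ip_eq0 f : (forall x, Om x -> f x = 0) -> nrm2 f = 0.
Proof.
move=> f0; rewrite -[RHS](@ip0l _ _ _ mu Om mOm (fun=> 0)).
exact: eq_ip.
Qed.

Lemma H10_test phi : test_function Om phi -> H10 phi (grad phi).
Proof.
move=> tp; have sp := test_smooth tp; split.
- exact: smooth_sqint.
- move=> i; rewrite (_ : (fun x => _) = partial i phi); last first.
    by apply/funext => x; rewrite mxE.
  exact/smooth_sqint/smooth_partial.
- move=> e e0; exists phi; split => // [|i].
    by rewrite ip_eq0 ?ltW// => x _; rewrite subrr.
  by rewrite ip_eq0 ?ltW// => x _; rewrite mxE subrr.
Qed.

Lemma H10_lin k u Du v Dv : H10 u Du -> H10 v Dv ->
  H10 (fun x => u x + k * v x) (fun x => Du x + k *: Dv x).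
Proof.
move=> [su sDu hu] [sv sDv hv].
have sDu' i : sq (fun x => (Du x + k *: Dv x) ord0 i).
  rewrite (_ : (fun x => _) = fun x => Du x ord0 i + k * Dv x ord0 i).
    by apply: sqintD => //; exact: sqintZ.
  by apply/funext => x; rewrite !mxE.
split => // [|e e0]; first by apply: sqintD => //; exact: sqintZ.
(* The constant by which the squared norm of u + k v exceeds those of u and v. *)
pose c := 2 * (1 + k ^+ 2); have k2 := sqr_ge0 k.
have c0 : 0 < c by rewrite /c; lra.
have ec : 0 < e / c by rewrite divr_gt0.
have [p [tp pu pDu]] := hu _ ec; have [q [tq qv qDv]] := hv _ ec.
have sp := test_smooth tp; have sq' := test_smooth tq.
have key f g f' g' : sq f -> sq g -> sq f' -> sq g' ->
    nrm2 (fun x => f x - f' x) <= e / c -> nrm2 (fun x => g x - g' x) <= e / c ->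
    nrm2 (fun x => (f x + k * g x) - (f' x + k * g' x)) <= e.
  move=> sf sg sf' sg' h1 h2.
  have sfd : sq (fun x => f x - f' x) by exact: sqintB.
  have sgd : sq (fun x => g x - g' x) by exact: sqintB.
  have skg : sq (fun x => k * (g x - g' x)) by exact: sqintZ.
  rewrite (_ : nrm2 _ = nrm2 (fun x => (f x - f' x) + k * (g x - g' x))); last first.
    by apply: eq_ip => x _; ring.
  apply: le_trans; first exact: ip_sqD.
  rewrite ipZl// ipZr//.
  have -> : e = 2 * (e / c + k ^+ 2 * (e / c)).
    by rewrite /c; field; rewrite gt_eqF//; lra.
  rewrite ler_pM2l// lerD// mulrA -expr2 ler_wpM2l//.
exists (p \+ k *: q); split.
- exact: testD tp (testZ k tq).
- by apply: key => //; exact: smooth_sqint.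
- move=> i; rewrite (_ : nrm2 _ = nrm2 (fun x => (partial i p x + k * partial i q x) -
      (Du x ord0 i + k * Dv x ord0 i))).
    by apply: key => //; exact/smooth_sqint/smooth_partial.
  apply: eq_ip => x _; rewrite !mxE (smooth_partialD i sp (smoothZ k sq')).
  all: by rewrite (smooth_partialZ i k sq').
Qed.

Lemma H10_ext u Du u' : {ae mu, forall x, Om x -> u x = u' x} ->
  measurable_fun Om u' -> H10 u Du -> H10 u' Du.
Proof.
move=> uu' mu' [su sDu hu].
have ae_nrm (f f' : E -> R) : {ae mu, forall x, Om x -> f x = f' x} ->
    measurable_fun Om f -> measurable_fun Om f' ->
    (\int[mu]_(x in Om) ((f x) ^+ 2)%:E = \int[mu]_(x in Om) ((f' x) ^+ 2)%:E)%E.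
  move=> ff mf mf'; apply: ae_eq_integral => //.
  - by apply: measurable_EFin; exact: measurable_funX.
  - by apply: measurable_EFin; exact: measurable_funX.
  - by apply: filterS ff => x h Ox; rewrite h.
have mu0 : measurable_fun Om u by case: su.
have su' : sq u'.
  split => //; apply/integrableP; split.
    by apply: measurable_EFin; exact: measurable_funX.
  have := ae_nrm _ _ uu' mu0 mu'; rewrite ip_EFin// => h.
  rewrite (_ : (\int[mu]_(x in Om) _)%E = (nrm2 u)%:E) ?ltry//.
  by rewrite h; apply: eq_integral => x _ /=; rewrite ger0_norm ?sqr_ge0.
split => // e e0; have [p [tp pu pDu]] := hu _ e0; exists p; split => //.
have sp : sq p by exact/smooth_sqint/(test_smooth tp).
have mp : measurable_fun Om p by case: sp.
rewrite -lee_fin -ip_EFin//; last exact: sqintB.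
rewrite -(ae_nrm (fun x => p x - u x)).
- by rewrite ip_EFin ?lee_fin//; exact: sqintB.
- by apply: filterS uu' => x h Ox; rewrite h.
- exact: measurable_funB.
- exact: measurable_funB.
Qed.

Lemma nrm2_le_cvg f g h : sq f -> sq g -> sq h -> forall e, nrm2 (fun x => f x - g x) <= e ->
  `|ip f h - ip g h| <= Num.sqrt e * Num.sqrt (nrm2 h).
Proof.
move=> sf sg sh e he; rewrite -ipBl//.
apply: le_trans; first by apply: ip_CS_abs => //; exact: sqintB.
apply: ler_wpM2r; first exact: sqrtr_ge0.
by rewrite ler_sqrt// (le_trans _ he)// ipff_ge0.
Qed.

Lemma eq_of_small (a b c : R) : (forall e, 0 < e -> `|a - b| <= e * c) -> a = b.
Proof.
move=> h; apply/eqP; rewrite -subr_eq0 -normr_le0; apply/ler_addgt0Pr => e e0.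
have c1 : 0 < `|c| + 1 by rewrite ltr_wpDl.
rewrite add0r (le_trans (h (e / (`|c| + 1)) _))// ?divr_gt0//.
rewrite mulrAC ler_pdivrMr// ler_wpM2l ?(ltW e0)//.
by rewrite (le_trans (ler_norm _))// lerDl.
Qed.

Lemma H10_weak_gradient u Du : H10 u Du -> weak_gradient Om u Du.
Proof.
move=> [su sDu hu] psi tp i.
rewrite -(ipE mu Om u) -(ipE mu Om (fun x => Du x ord0 i)).
have sp := test_smooth tp; have sps : sq psi by exact: smooth_sqint.
have spp : sq (partial i psi) by exact/smooth_sqint/smooth_partial.
apply: (@eq_of_small _ _ (Num.sqrt (nrm2 (partial i psi)) + Num.sqrt (nrm2 psi))) => e e0.
have e2 : 0 < e ^+ 2 by rewrite exprn_gt0.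
have [phi [tphi h1 h2]] := hu _ e2.
have sphi := test_smooth tphi.
have I := integration_by_parts_test oO bO i sphi tp.
have k1 := nrm2_le_cvg (smooth_sqint oO bO sphi) su spp h1.
have k2 := nrm2_le_cvg (smooth_sqint oO bO (smooth_partial i sphi)) (sDu i) sps (h2 i).
have se : Num.sqrt (e ^+ 2) = e by rewrite sqrtr_sqr gtr0_norm.
rewrite se I in k1; rewrite se in k2.
rewrite mulrDr; apply: (le_trans _ (lerD k1 k2)).
apply: (le_trans _ (ler_normD _ _)); rewrite -[leLHS]normrN.
by rewrite le_eqVlt; apply/orP; left; apply/eqP; congr (`|_|); ring.
Qed.

Lemma H10_H1_0 u Du : H10 u Du -> H1_0 Om u Du.
Proof.
move=> hu; have [su sDu h] := hu; split.
  by split; [exact/L2P|move=> i; exact/L2P|exact: H10_weak_gradient].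
have /choice[phi hphi] n : exists phi, [/\ test_function Om phi,
    nrm2 (fun x => phi x - u x) <= (n.+1%:R^-1) ^+ 2 &
    forall i, nrm2 (fun x => partial i phi x - Du x ord0 i) <= (n.+1%:R^-1) ^+ 2].
  by apply: h; rewrite exprn_gt0// invr_gt0.
have cvg0 (f : (E -> R)^nat) : (forall n, sq (f n)) ->
    (forall n, nrm2 (f n) <= (n.+1%:R^-1) ^+ 2) -> L2norm Om (f n) @[n --> \oo] --> 0%E.
  move=> sf fn; rewrite (_ : (fun n => L2norm Om (f n)) = fun n => (Num.sqrt (nrm2 (f n)))%:E).
    apply: cvg_EFin; first exact: nearW.
    apply: (@squeeze_cvgr _ _ _ _ (fun=> 0) (fun n => n.+1%:R^-1)).
    - apply: nearW => n /=; rewrite sqrtr_ge0/=.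
      rewrite -[leRHS]gtr0_norm ?invr_gt0// -sqrtr_sqr ler_sqrt// sqr_ge0//.
    - exact: cvg_cst.
    - exact: cvg_harmonic.
  by apply/funext => n; rewrite L2normE.
exists phi; split.
- by move=> n; case: (hphi n).
- apply: cvg0 => n; have [tp h1 h2] := hphi n => //.
  by apply: sqintB => //; exact/smooth_sqint/(test_smooth tp).
- move=> i; apply: cvg0 => n; have [tp h1 h2] := hphi n => //.
  by apply: sqintB => //; exact/smooth_sqint/smooth_partial/(test_smooth tp).
Qed.

Lemma H1_0_H10 u Du : H1_0 Om u Du -> H10 u Du.
Proof.
move=> [[/L2P su sDu _] [phi [tp cu cD]]].
have sDu' i : sq (fun x => Du x ord0 i) by apply/L2P; exact: sDu.
have tosq (f : (E -> R)^nat) (e : R) : (forall n, sq (f n)) -> 0 < e ->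
    L2norm Om (f n) @[n --> \oo] --> 0%E -> \forall n \near \oo, nrm2 (f n) <= e.
  move=> sf e0; rewrite (_ : (fun n => L2norm Om (f n)) = fun n => (Num.sqrt (nrm2 (f n)))%:E).
    move=> /fine_cvgP[_] /cvgrPdist_le/(_ (Num.sqrt e)); rewrite sqrtr_gt0 => /(_ e0).
    apply: filterS => n /=; rewrite sub0r normrN ger0_norm ?sqrtr_ge0//.
    by rewrite ler_sqrt// ltW.
  by apply/funext => n; rewrite L2normE.
split => // e e0.
have n1 : \forall n \near \oo, nrm2 (fun x => phi n x - u x) <= e.
  by apply: tosq => // n; apply: sqintB => //; exact/smooth_sqint/(test_smooth (tp n)).
have n2 : \forall n \near \oo, forall i, nrm2 (fun x => partial i (phi n) x - Du x ord0 i) <= e.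
  apply: filter_forall => i; apply: tosq => // n; apply: sqintB => //.
  exact/smooth_sqint/smooth_partial/(test_smooth (tp n)).
have [n [h1 h2]] := filter_ex (filterI n1 n2).
by exists (phi n).
Qed.

End sobolev_bridge.

(** * The linear Dirichlet problem *)

Section elliptic.
Context {R : realType} {d : nat}.
Local Notation E := 'rV[R]_d.
Local Notation mu := (@lebesgue_rV R d).
Variable Om : set E.
Hypotheses (oO : open Om) (bO : bounded_set Om).
Implicit Types (u v : E -> R) (Du Dv : E -> E).
Local Notation sq := (sqint mu Om).
Local Notation ip := (ip mu Om).
Local Notation nrm2 f := (ip f f).
Let mOm := open_measurable_rV oO.
Let finOm := bounded_rV_lty mOm bO.
Local Hint Resolve mOm finOm : core.

(** [- Delta u = g] in terms of the gradient of [u], tested against test functions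
    only; [weak_laplace_H10] extends it to their closure. *)
Definition weak_laplace Du g := forall psi, test_function Om psi ->
  \sum_(i < d) ip (fun x => Du x ord0 i) (partial i psi) = ip g psi.

(** Both sides are continuous in the [H^1] norm of the test function. *)
Lemma weak_laplace_H10 Du g : (forall i, sq (fun x => Du x ord0 i)) -> sq g ->
  weak_laplace Du g -> forall v Dv, H10 Om v Dv ->
  \sum_(i < d) ip (fun x => Du x ord0 i) (fun x => Dv x ord0 i) = ip g v.
Proof.
move=> sDu sg hw v Dv [sv sDv hv].
pose K := \sum_(i < d) Num.sqrt (nrm2 (fun x => Du x ord0 i)) + Num.sqrt (nrm2 g).
apply: (@eq_of_small _ _ _ K) => e e0.
have e2 : 0 < e ^+ 2 by rewrite exprn_gt0.
have [psi [tp h1 h2]] := hv _ e2; have sp := test_smooth tp.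
have se : Num.sqrt (e ^+ 2) = e by rewrite sqrtr_sqr gtr0_norm.
have k1 := nrm2_le_cvg oO (smooth_sqint oO bO sp) sv sg h1; rewrite se in k1.
rewrite -(subrK (ip g psi) (_ - _)) mulrDr.
rewrite (_ : _ - _ - _ + _ = (\sum_(i < d) ip (fun x => Du x ord0 i) (fun x => Dv x ord0 i)
   - ip g psi) + (ip g psi - ip g v)); last by ring.
apply: le_trans (ler_normD _ _) _; apply: lerD; last first.
  by rewrite !(ipC _ _ g).
rewrite -hw// -sumrB; apply: le_trans (ler_norm_sum _ _ _) _.
rewrite mulr_sumr; apply: ler_sum => i _.
have := nrm2_le_cvg oO (smooth_sqint oO bO (smooth_partial i sp)) (sDv i) (sDu i) (h2 i).
by rewrite se distrC !(ipC _ _ (fun x => Du x ord0 i)).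
Qed.

Lemma partial_sub i phi psi : smooth phi -> smooth psi ->
  partial i (phi - psi : E -> R) = (partial i phi - partial i psi : E -> R).
Proof.
move=> sp sq'; have sN := smoothZ (-1) sq'.
rewrite -(scaleN1r psi) -(scaleN1r (partial i psi)) -(smooth_partialZ i (-1) sq').
exact: smooth_partialD.
Qed.

(** The linear problem [- Delta v + k v = g].  The Dirichlet form with [k > 0]
    dominates the [H^1] norm, so minimising sequences converge there. *)
Lemma solve_linear (k : R) g : 0 < k -> sq g ->
  exists v Dv, H10 Om v Dv /\ weak_laplace Dv (fun x => g x - k * v x).
Proof.
move=> k0 sg.
pose a (phi psi : E -> R) := \sum_(i < d) ip (partial i phi) (partial i psi) + k * ip phi psi.
have ts phi : test_function Om phi -> sq phi by move=> tp; exact: test_sqint.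
have tps phi i : test_function Om phi -> sq (partial i phi).
  by move=> tp; exact/ts/test_partial.
have nn phi : 0 <= \sum_(i < d) nrm2 (partial i phi).
  by apply: sumr_ge0 => i _; exact: ipff_ge0.
have aC phi psi : a phi psi = a psi phi.
  rewrite /a.
  have e1 : ip phi psi = ip psi phi by exact: ipC.
  have e2 i : ip (partial i phi) (partial i psi) = ip (partial i psi) (partial i phi) by exact: ipC.
  rewrite e1.
  congr (_ + _).
  apply: eq_bigr => i _.
  exact: e2.
have a_ge0 phi : 0 <= a phi phi.
  by rewrite /a addr_ge0 ?nn// mulr_ge0 ?ipff_ge0// ltW.
have aD x y z : test_function Om x -> test_function Om y -> test_function Om z ->
    a (x \+ y) z = a x z + a y z.
  move=> tx ty tz; rewrite /a (ipDl mOm (ts _ tx) (ts _ ty) (ts _ tz)) mulrDr.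
  rewrite addrACA; congr (_ + _); rewrite -big_split/=; apply: eq_bigr => i _.
  rewrite (smooth_partialD i (test_smooth tx) (test_smooth ty)).
  by rewrite (ipDl mOm (tps _ i tx) (tps _ i ty) (tps _ i tz)).
have aZ c x z : test_function Om x -> test_function Om z -> a (c *: x) z = c * a x z.
  move=> tx tz; rewrite /a (ipZl mOm c (ts _ tx) (ts _ tz)) mulrDr mulr_sumr.
  rewrite mulrCA; congr (_ + _); apply: eq_bigr => i _.
  by rewrite (smooth_partialZ i c (test_smooth tx)) (ipZl mOm c (tps _ i tx) (tps _ i tz)).
have a_coercive x : test_function Om x -> - (nrm2 g / k) <= a x x - 2 * ip g x.
  move=> tx; have sx := ts _ tx; have skx := sqintZ mOm k sx.
  (* Completing the square. *)
  have := ipff_ge0 mu Om (fun y => k * x y - g y).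
  have sd := sqintB mOm skx sg.
  rewrite ipBl// !ipBr// !ipZl// !ipZr//.
  rewrite (ipC _ _ g) => h; rewrite /a.
  have := nn x; set A := \sum_(i < d) _; set B := nrm2 x in h *; set C := ip x g in h *.
  set G := nrm2 g in h *.
  have : - (G / k) <= k * B - 2 * C.
    by rewrite -mulNr ler_pdivrMr//; nra.
  by lra.
have [p [tp pc pe]] : exists p : nat -> (E -> R),
  [/\ forall n, test_function Om (p n),
      forall n m, a (p n - p m) (p n - p m) <= 2 * (n.+1%:R^-1 + m.+1%:R^-1) &
      forall n y, test_function Om y -> (a (p n) y - ip g y) ^+ 2 <= a y y * n.+1%:R^-1].
  apply: (@dirichlet_minimizing_sequence _ _ (test_function Om) a (ip g) (nrm2 g / k)).
  - exact: test0.
  - by move=> x y tx ty; exact: testD.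
  - by move=> c x tx; exact: testZ.
  - exact: aC.
  - exact: a_ge0.
  - exact: aD.
  - exact: aZ.
  - by move=> x y tx ty; exact: (ipDr mOm (ts _ tx) (ts _ ty) sg).
  - by move=> c x tx; exact: (ipZr mOm c (ts _ tx) sg).
  - exact: a_coercive.
have small (e : R) : 0 < e -> exists N, forall n, (N <= n)%N -> n.+1%:R^-1 <= e.
  move=> e0; have [N _ hN] := near_infty_natSinv_lt (PosNum e0).
  by exists N => n Nn; apply/ltW/hN.
have cauchy_of (f : (E -> R)^nat) (c : R) : 0 < c ->
    (forall n m, c * nrm2 (fun x => f n x - f m x) <= a (p n - p m) (p n - p m)) ->
    cauchy2 mu Om f.
  move=> c0 fa e e0; have ce : 0 < c * e / 4 by rewrite divr_gt0// mulr_gt0.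
  have [N hN] := small _ ce; exists N => n m Nn Nm.
  rewrite -(ler_pM2l c0); apply: le_trans (fa n m) _; apply: le_trans (pc n m) _.
  move: (hN _ Nn) (hN _ Nm); move: (n.+1%:R^-1) (m.+1%:R^-1) => r s; lra.
have cp : cauchy2 mu Om p.
  apply: (cauchy_of _ k) => // n m; rewrite /a lerDr; exact: nn.
have cDp i : cauchy2 mu Om (fun n => partial i (p n)).
  apply: (cauchy_of _ 1) => // n m; rewrite mul1r /a.
  rewrite (bigD1 i)//= -addrA (partial_sub i (test_smooth (tp n)) (test_smooth (tp m))) lerDl.
  rewrite addr_ge0 ?mulr_ge0 ?ipff_ge0 ?(ltW k0)//.
  by apply: sumr_ge0 => j _; exact: ipff_ge0.
have [v sv hv] := sqint_complete mOm (fun n => ts _ (tp n)) cp.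
have /choice[V hV] i : exists l, sq l /\ forall e : R, 0 < e ->
    exists N, forall n, (N <= n)%N -> nrm2 (fun x => partial i (p n) x - l x) <= e.
  by have [l sl hl] := sqint_complete mOm (fun n => tps _ i (tp n)) (cDp i); exists l.
pose Dv x : E := \row_i V i x.
have DvE i : (fun x => Dv x ord0 i) = V i by apply/funext => x; rewrite mxE.
have sV i : sq (V i) by case: (hV i).
have hall e : 0 < e -> exists N, forall n, (N <= n)%N -> nrm2 (fun x => p n x - v x) <= e /\
    forall i, nrm2 (fun x => partial i (p n) x - V i x) <= e.
  move=> e0; have [N hN] := hv _ e0.
  have /choice[M hM] i : exists N, forall n, (N <= n)%N ->
    nrm2 (fun x => partial i (p n) x - V i x) <= e by have [_] := hV i; apply.
  exists (maxn N (\max_i M i)) => n; rewrite geq_max => /andP[Nn Mn]; split; first exact: hN.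
  by move=> i; apply: hM; apply: leq_trans Mn; exact: leq_bigmax.
have hH : H10 Om v Dv.
  split => // [i|e e0]; first by rewrite DvE.
  have [N /(_ N (leqnn _))[h1 h2]] := hall _ e0; exists (p N); split => // i.
  rewrite (_ : nrm2 _ = nrm2 (fun x => partial i (p N) x - V i x))//.
  by apply: eq_ip => x _; rewrite mxE.
exists v, Dv; split => // psi tpsi; have spsi := ts _ tpsi.
rewrite ipBl//; last exact: sqintZ.
rewrite ipZl//.
suff : \sum_(i < d) ip (fun x => Dv x ord0 i) (partial i psi) + k * ip v psi = ip g psi.
  by move=> <-; rewrite addrK.
pose K := \sum_(i < d) Num.sqrt (nrm2 (partial i psi)) + k * Num.sqrt (nrm2 psi) + (a psi psi + 1).
apply: (@eq_of_small _ _ _ K) => e e0.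
have e2 : 0 < e ^+ 2 by rewrite exprn_gt0.
have [N hN] := hall _ e2; have [M hM] := small _ e2.
have [h1 h2] := hN (maxn N M) (leq_maxl _ _); have h3 := hM (maxn N M) (leq_maxr _ _).
set n := maxn N M in h1 h2 h3.
have se : Num.sqrt (e ^+ 2) = e by rewrite sqrtr_sqr gtr0_norm.
have app : a psi psi >= 0 by rewrite /a addr_ge0 ?nn// mulr_ge0 ?ipff_ge0// ltW.
have k3 : `|a (p n) psi - ip g psi| <= e * (a psi psi + 1).
  have K1 : 0 <= e * (a psi psi + 1).
    by apply: mulr_ge0; [exact: ltW|exact: addr_ge0].
  rewrite -ler_sqr ?nnegrE// real_normK ?num_real//; apply: le_trans (pe n psi tpsi) _.
  apply: le_trans (ler_wpM2l app h3) _; rewrite mulrC exprMn ler_wpM2l ?sqr_ge0//.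
  by nra.
have k1 := nrm2_le_cvg oO (ts _ (tp n)) sv spsi h1; rewrite se in k1.
have k2 i := nrm2_le_cvg oO (tps _ i (tp n)) (sV i) (tps _ i tpsi) (h2 i).
rewrite (_ : _ - ip g psi = (\sum_(i < d) ip (fun x => Dv x ord0 i) (partial i psi) -
   \sum_(i < d) ip (partial i (p n)) (partial i psi)) + k * (ip v psi - ip (p n) psi) +
   (a (p n) psi - ip g psi)); last by rewrite /a; ring.
rewrite /K [leRHS]mulrDr [X in _ <= X + _]mulrDr; apply: le_trans (ler_normD _ _) _; apply: lerD => //.
apply: le_trans (ler_normD _ _) _; apply: lerD.
  rewrite -sumrB; apply: le_trans (ler_norm_sum _ _ _) _.
  rewrite mulr_sumr; apply: ler_sum => i _.
  by rewrite DvE distrC -[X in X * _]se; exact: k2.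
by rewrite normrM gtr0_norm// mulrCA ler_pM2l// distrC.
Qed.

End elliptic.

(** * The weak maximum principle *)

Section comparison.
Context {R : realType} {d : nat}.
Local Notation E := 'rV[R]_d.
Local Notation mu := (@lebesgue_rV R d).
Variable Om : set E.
Hypotheses (oO : open Om) (bO : bounded_set Om).
Implicit Types (u v : E -> R) (Du Dv : E -> E).
Local Notation sq := (sqint mu Om).
Local Notation ip := (ip mu Om).
Local Notation nrm2 f := (ip f f).
Let mOm := open_measurable_rV oO.
Let finOm := bounded_rV_lty mOm bO.
Local Hint Resolve mOm finOm : core.

Lemma nrm2_eq0_ae f : sq f -> nrm2 f <= 0 -> {ae mu, forall x, Om x -> f x = 0}.
Proof.
move=> sf f0; have n0 : nrm2 f = 0 by apply/le_anti; rewrite f0 ipff_ge0.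
have := ip_EFin mOm sf; rewrite n0 => i0.
have mf2 : measurable_fun Om (fun x => (f x ^+ 2)%:E).
  by apply: measurable_EFin; apply: measurable_funX; case: sf.
have /(ae_eq_integral_abs mu mOm mf2) : (\int[mu]_(x in Om) `|(f x ^+ 2)%:E| = 0)%E.
  by apply: (etrans _ i0); apply: eq_integral => x _ /=; rewrite ger0_norm ?sqr_ge0.
apply: filterS => x h Ox; have [/eqP] := h Ox.
by rewrite sqrf_eq0 => /eqP.
Qed.

Lemma ip_le_abs a b c : sq a -> sq b -> sq c ->
  (forall x, Om x -> a x * b x <= `|a x| * c x) -> ip a b <= ip (fun x => `|a x|) c.
Proof.
move=> sa sb sc h; apply: le_ip => //; first exact: integM.
by apply: integM => //; exact: sqint_norm.
Qed.

Lemma pos_part_lip (s t : R) : `|Num.max s 0 - Num.max t 0| <= `|s - t|.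
Proof.
rewrite !maxr_absE !addr0 !subr0.
have -> : (s + `|s|) / 2 - (t + `|t|) / 2 = ((s - t) + (`|s| - `|t|)) / 2 by field.
rewrite normrM [`|2^-1|]gtr0_norm ?invr_gt0// ler_pdivrMr//.
apply: le_trans (ler_normD _ _) _.
by have := ler_dist_dist s t; lra.
Qed.

(** Every error term of the comparison argument is of this form: a fixed
    function against one that is [O(e)] in square mean. *)
Lemma ip_abs_small a b (k e : R) : sq a -> sq b -> 0 < e -> nrm2 b <= e ^+ 2 ->
  ip (fun x => `|a x|) (fun x => `|b x| + k * e) <=
  e * (Num.sqrt (nrm2 a) + k * ip (fun x => `|a x|) (fun=> 1)).
Proof.
move=> sa sb e0 be; have sna := sqint_norm mOm sa; have snb := sqint_norm mOm sb.
have s1 := sqint_cst mOm finOm 1; have ske := sqint_cst mOm finOm (k * e).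
rewrite ipDr// mulrDr; apply: lerD; last first.
  rewrite (_ : (fun=> k * e) = (fun x : E => (k * e) * 1)); last first.
    by apply/funext => x; rewrite mulr1.
  by rewrite ipZr// mulrCA mulrA.
apply: le_trans (ler_norm _) _; apply: le_trans; first exact: ip_CS_abs.
rewrite !ip_norm// mulrC ler_wpM2r ?sqrtr_ge0//.
have -> : e = Num.sqrt (e ^+ 2) by rewrite sqrtr_sqr gtr0_norm.
by rewrite ler_sqrt// exprn_ge0// ltW.
Qed.

(** The weak maximum principle, tested with a smooth approximation of the
    positive part of [h - q].  Because [q] is nonnegative, subtracting the
    value for [h = 0] keeps the support compact at a cost of order [e]; the
    bound [|Dq| <= C q] makes the gradient of that correction small too. *)
Lemma comparison h Dh (q g : E -> R) (C k : R) : H10 Om h Dh -> smooth q ->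
  (forall x, Om x -> 0 <= q x) ->
  0 <= C -> (forall i x, Om x -> `|partial i q x| <= C * q x) ->
  0 < k -> sq g -> (forall x, Om x -> g x <= 0) ->
  (forall psi, test_function Om psi ->
    \sum_(i < d) ip (fun x => Dh x ord0 i - partial i q x) (partial i psi) +
    k * ip (fun x => h x - q x) psi = ip g psi) ->
  {ae mu, forall x, Om x -> h x <= q x}.
Proof.
move=> [sh sDh hh] smq q0 C0 dq k0 sg g0 heq.
have ssq := smooth_sqint oO bO smq.
have sspq i : sq (partial i q) by exact/smooth_sqint/smooth_partial.
pose z x := h x - q x; have sz : sq z by exact: sqintB.
pose Z i x := Dh x ord0 i - partial i q x.
have sZ i : sq (Z i) by exact: sqintB.
pose zp x := Num.max (z x) 0.
have szp : sq zp.
  apply: (@le_sqint _ _ _ _ _ mOm zp z) => //.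
    by apply: measurable_maxr => //; case: sz.
  move=> x _; rewrite /zp; have [_|z0] := leP (z x) 0; first by rewrite normr0.
  by [].
pose A (a : E -> R) (c : R) := Num.sqrt (nrm2 a) + c * ip (fun x => `|a x|) (fun=> 1).
pose K := A g 2 + k * A z 2 + \sum_(i < d) A (Z i) C.
have main e : 0 < e -> k * nrm2 zp <= e * K.
  move=> e0; have e2 : 0 < e ^+ 2 by rewrite exprn_gt0.
  have [phi [tphi h1 h2]] := hh _ e2; have sphi := test_smooth tphi.
  have ssphi := smooth_sqint oO bO sphi.
  have smN : smooth (- q : E -> R).
    by rewrite -(scaleN1r q); exact: smoothZ.
  have pN i x : partial i (- q) x = - partial i q x.
    by rewrite -(scaleN1r q) smooth_partialZ// -[LHS]/(-1 * partial i q x) mulN1r.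
  have smB : smooth (phi \+ (- q)) by exact: smoothD.
  have pB i x : partial i (phi \+ (- q)) x = partial i phi x - partial i q x.
    by rewrite smooth_partialD//= pN.
  pose psi : E -> R := (smooth_pos e \o (phi \+ (- q))) \+ (-1) *: (smooth_pos e \o (- q)).
  have psiE x : psi x = smooth_pos e (phi x - q x) - smooth_pos e (- q x).
    by rewrite -[LHS]/(_ + -1 * smooth_pos e (- q x)) mulN1r.
  have sm1 : smooth (smooth_pos e \o (phi \+ (- q))) by exact: smooth_smooth_pos.
  have sm2 : smooth (smooth_pos e \o (- q)) by exact: smooth_smooth_pos.
  have smpsi : smooth psi := smoothD sm1 (smoothZ (-1) sm2).
  have tpsi : test_function Om psi.
    apply: (test_of_smooth tphi) => // x p0.
    by rewrite psiE p0 sub0r subrr.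
  have spsi := smooth_sqint oO bO smpsi.
  have sppsi i : sq (partial i psi) by exact/smooth_sqint/smooth_partial.
  have dpsi i x : partial i psi x =
      dsmooth_pos e (phi x - q x) * (partial i phi x - partial i q x) +
      dsmooth_pos e (- q x) * partial i q x.
    rewrite /psi (smooth_partialD i sm1 (smoothZ (-1) sm2)) (smooth_partialZ i (-1) sm2).
    have p1 := partial_smooth_pos e0 i x smB; have p2 := partial_smooth_pos e0 i x smN.
    rewrite pB in p1; rewrite pN in p2.
    transitivity (partial i (smooth_pos e \o (phi \+ (- q))) x +
      -1 * partial i (smooth_pos e \o (- q)) x); first by [].
    by rewrite p1 p2 /=; ring.
  have sphih : sq (fun x => phi x - h x) by exact: sqintB.
  have sDphi i : sq (fun x => partial i phi x - Dh x ord0 i).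
    by apply: sqintB => //; exact/smooth_sqint/smooth_partial.
  (* The test function is close to the positive part of z in square mean. *)
  have B x : Om x -> `|psi x - zp x| <= `|phi x - h x| + 2 * e.
    move=> Ox; rewrite psiE.
    have a1 := smooth_pos_approx e0 (phi x - q x).
    have a2 := smooth_pos_opp e0 (q0 _ Ox).
    have a3 : `|Num.max (phi x - q x) 0 - zp x| <= `|phi x - h x|.
      rewrite (_ : phi x - h x = (phi x - q x) - z x); last by rewrite /z; ring.
      exact: pos_part_lip.
    move: a1 a2 a3; rewrite !ler_norml => /andP[a1 a1'] /andP[a2 a2'] /andP[a3 a3'].
    by apply/andP; split; lra.
  (* Up to errors, Z against the gradient of psi is a nonnegative multiple of
     the square of Z. *)
  have Gi i : - ip (Z i) (partial i psi) <= e * A (Z i) C.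
    rewrite -ipNl//; apply: le_trans; last exact: (ip_abs_small C (sZ i) (sDphi i) e0 (h2 i)).
    have sc : sq (fun x => `|partial i phi x - Dh x ord0 i| + C * e).
      by apply: sqintD => //; [exact: sqint_norm|exact: sqint_cst].
    apply: le_ip => //; first by apply: integM => //; exact: sqintN.
      by apply: integM => //; exact: sqint_norm.
    move=> x Ox; rewrite dpsi.
    have /andP[w0 w1] := dsmooth_pos_itv e0 (phi x - q x).
    have wq : `|dsmooth_pos e (- q x) * partial i q x| <= C * e.
      have := dsmooth_pos_opp e0 (q0 _ Ox); rewrite !(normrM (dsmooth_pos e (- q x))) (ger0_norm (q0 _ Ox)) => h3.
      apply: (@le_trans _ _ (`|dsmooth_pos e (- q x)| * (C * q x))).
        by apply: ler_wpM2l => //; exact: dq.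
      by rewrite mulrCA ler_wpM2l.
    rewrite (_ : partial i phi x - partial i q x = Z i x + (partial i phi x - Dh x ord0 i));
      last by rewrite /Z; ring.
    move: (dsmooth_pos e (phi x - q x)) w0 w1 (dsmooth_pos e (- q x) * _) wq => w w0 w1 r wr.
    move: (partial i phi x - Dh x ord0 i) (Z i x) => b t.
    rewrite mulrDr mulNr mulNr -opprD.
    have p1 : 0 <= t * (w * t) by rewrite mulrCA mulr_ge0// -expr2 sqr_ge0.
    have p2 : - (t * (w * b)) <= `|t| * `|b|.
      apply: le_trans (ler_norm _) _; rewrite normrN !normrM (ger0_norm w0).
      by rewrite ler_wpM2l// ler_piMl.
    have p3 : - (t * r) <= `|t| * (C * e).
      apply: le_trans (ler_norm _) _; rewrite normrN normrM ler_wpM2l//.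
    by rewrite !mulrDr; lra.
  have := heq _ tpsi; rewrite -/z => H.
  have Hg : ip g psi <= e * A g 2.
    apply: le_trans; last exact: (ip_abs_small 2 sg sphih e0 h1).
    apply: ip_le_abs => //.
      by apply: sqintD => //; [exact: sqint_norm|exact: sqint_cst].
    move=> x Ox; have -> : g x * psi x = g x * zp x + g x * (psi x - zp x) by ring.
    have zp0 : g x * zp x <= 0 by rewrite mulr_le0_ge0 ?g0// /zp le_max lexx orbT.
    have : g x * (psi x - zp x) <= `|g x| * (`|phi x - h x| + 2 * e).
      by apply: le_trans (ler_norm _) _; rewrite normrM ler_wpM2l// B.
    by lra.
  have Hz : nrm2 zp - ip z psi <= e * A z 2.
    have -> : nrm2 zp = ip z zp.
      rewrite !ipE; apply: eq_Rintegral => x _; rewrite /zp.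
      by have [z0|z0] := leP (z x) 0; rewrite ?mulr0.
    rewrite -ipBr//; apply: le_trans; last exact: (ip_abs_small 2 sz sphih e0 h1).
    apply: ip_le_abs => //; first exact: sqintB.
      by apply: sqintD => //; [exact: sqint_norm|exact: sqint_cst].
    move=> x Ox; apply: le_trans (ler_norm _) _.
    by rewrite normrM ler_wpM2l// distrC B.
  have HZ : - \sum_(i < d) ip (Z i) (partial i psi) <= e * \sum_(i < d) A (Z i) C.
    by rewrite -sumrN mulr_sumr; apply: ler_sum => i _; exact: Gi.
  have HH : \sum_(i < d) ip (Z i) (partial i psi) + k * ip z psi = ip g psi by exact: H.
  have Hkz : k * nrm2 zp - k * ip z psi <= k * (e * A z 2) by rewrite -mulrBr ler_pM2l.
  move: HH Hg Hkz HZ; rewrite /K.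
  move: (\sum_(i < d) ip _ _) (\sum_(i < d) A _ _) (A g 2) (A z 2) => S1 S2 a1 a2.
  move: (ip g psi) (nrm2 zp) (ip z psi) => b1 b2 b3 HH Hg Hkz HZ.
  have -> : e * (a1 + k * a2 + S2) = e * a1 + k * (e * a2) + e * S2 by ring.
  by lra.
have n0 : nrm2 zp <= 0.
  rewrite -(ler_pM2l k0) mulr0; apply/ler_addgt0Pr => e e0; rewrite add0r.
  have c1 : 0 < `|K| + 1 by rewrite ltr_wpDl.
  apply: le_trans (main (e / (`|K| + 1)) _) _; first by rewrite divr_gt0.
  rewrite mulrAC ler_pdivrMr// ler_wpM2l ?(ltW e0)//.
  by rewrite (le_trans (ler_norm _))// lerDl.
apply: filterS (nrm2_eq0_ae szp n0) => x hx Ox; have := hx Ox.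
by rewrite /zp /z; have [|_ /eqP] := leP (h x - q x) 0; rewrite ?subr_le0// subr_eq0 => /eqP ->.
Qed.

End comparison.

(** * Lipschitz regularisation of the nonlinearity *)

Section sup_convolution.
Context {R : realType}.
Variables (f : R -> R) (W : R).
Hypotheses (cf : continuous f) (W0 : 0 <= W).
Implicit Types s t K : R.

Lemma continuous_bounded_itv : exists2 B, 0 <= B & forall s, `|s| <= W -> `|f s| <= B.
Proof.
have cI : compact `[- W, W]%classic by exact: segment_compact.
have := continuous_compact (continuous_subspaceT cf) cI.
move=> /compact_bounded[C [_ hC]]; exists (Num.max (C + 1) 0); first by rewrite le_max lexx orbT.
move=> s sW; rewrite le_max (hC (C + 1)) ?ltrDl//.
by exists s => //=; rewrite in_itv/= -ler_norml.
Qed.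

Lemma unif_continuous_itv (e : R) : 0 < e -> exists2 eta : R, 0 < eta &
  forall s t, `|s| <= W -> `|t| <= W -> `|s - t| < eta -> f s <= f t + e.
Proof.
move=> e0;
(* Otherwise bad pairs accumulate at a point where f is continuous. *)
apply: contrapT => H.
have /choice[st hst] n : exists p : R * R, [/\ `|p.1| <= W, `|p.2| <= W,
    `|p.1 - p.2| < n.+1%:R^-1 & f p.2 + e < f p.1].
  apply: contrapT => Hn; apply: H; exists n.+1%:R^-1; first by rewrite invr_gt0.
  move=> s t sW tW st; rewrite leNgt; apply/negP => fst.
  by apply: Hn; exists (s, t).
have cI : compact `[- W, W]%classic by exact: segment_compact.
have FI : ((fun n => (st n).2) @ \oo) `[- W, W]%classic.
  by exists 0%N => // n _ /=; rewrite in_itv/= -ler_norml; case: (hst n).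
have [p0 [_ clp]] := cI _ _ FI; pose p : R := p0.
have e2 : 0 < e / 2 by rewrite divr_gt0.
have [eta /= eta0 heta] : exists2 eta : R, 0 < eta & forall s, `|p - s| < eta -> `|f p - f s| < e / 2.
  have /cvgrPdist_lt/(_ _ e2) : f s @[s --> p] --> f p by exact: cf.
  by move=> /nbhs_ballP[eta /= eta0 h]; exists eta => // s ps; exact: h.
have eta2 : 0 < eta / 2 by rewrite divr_gt0.
have [N _ hN] := near_infty_natSinv_lt (PosNum eta2).
have FN : ((fun n => (st n).2) @ \oo) [set t | exists2 n, (N <= n)%N & t = (st n).2].
  by exists N => // n /= Nn; exists n.
have [_ [[n Nn ->] pn]] := clp _ _ FN (nbhsx_ballx p _ eta2).
have [sW tW st_n fst] := hst n.
have pn' : `|p - (st n).2| < eta / 2 by [].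
have n1 : n.+1%:R^-1 < eta / 2 by exact: hN.
have sp : `|p - (st n).1| < eta.
  have -> : p - (st n).1 = (p - (st n).2) - ((st n).1 - (st n).2) by ring.
  apply: le_lt_trans (ler_normB _ _) _.
  by move: pn' n1 st_n; move: (n.+1%:R^-1) => r; lra.
have tp : `|p - (st n).2| < eta by apply: lt_trans pn' _; lra.
have := heta _ sp; have := heta _ tp; rewrite !ltr_norml => /andP[h1 h2] /andP[h3 h4].
by lra.
Qed.

(** The sup-convolution of [f] on [[-W, W]]: the least [K]-Lipschitz function
    above [f] there.  It decreases with [K], which makes a supersolution for one
    value of [K] a supersolution for every larger one. *)
Definition supconv K t := sup [set f s - K * `|s - t| | s in [set s | `|s| <= W]].

Section bounds.
Variable B : R.
Hypothesis fB : forall s, `|s| <= W -> `|f s| <= B.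

Lemma supconv_ub K t s : 0 <= K -> `|s| <= W -> f s - K * `|s - t| <= supconv K t.
Proof.
move=> K0 sW; apply: ub_le_sup; last by exists s.
exists B => _ [r /= rW <-]; have := fB rW; rewrite ler_norml => /andP[_ h].
by apply: le_trans h; rewrite gerBl mulr_ge0.
Qed.

Lemma supconv_le K t M : (forall s, `|s| <= W -> f s - K * `|s - t| <= M) -> supconv K t <= M.
Proof.
move=> h; apply: ge_sup; first by exists (f 0 - K * `|0 - t|), 0 => //=; rewrite normr0.
by move=> _ [s /= sW <-]; exact: h.
Qed.

Lemma supconv_ge K t : 0 <= K -> `|t| <= W -> f t <= supconv K t.
Proof. by move=> K0 tW; have := supconv_ub t K0 tW; rewrite subrr normr0 mulr0 subr0. Qed.

Lemma supconv_norm_le K t : 0 <= K -> `|t| <= W -> `|supconv K t| <= B.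
Proof.
move=> K0 tW; rewrite ler_norml; apply/andP; split.
  by apply: le_trans (supconv_ge K0 tW); have := fB tW; rewrite ler_norml => /andP[].
apply: supconv_le => s sW; have := fB sW; rewrite ler_norml => /andP[_ h].
by apply: le_trans h; rewrite gerBl mulr_ge0.
Qed.

Lemma supconv_antitone K K' t : 0 <= K -> K <= K' -> supconv K' t <= supconv K t.
Proof.
move=> K0 KK; apply: supconv_le => s sW; apply: le_trans (supconv_ub t K0 sW).
by rewrite lerD2l lerN2 ler_wpM2r.
Qed.

Lemma supconv_lip K t t' : 0 <= K -> supconv K t <= supconv K t' + K * `|t - t'|.
Proof.
move=> K0; apply: supconv_le => s sW; have := supconv_ub t' K0 sW.
have : K * `|s - t'| <= K * (`|s - t| + `|t - t'|).
  by apply: ler_wpM2l => //; rewrite (_ : s - t' = (s - t) + (t - t')) ?ler_normD//; ring.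
by rewrite mulrDr; lra.
Qed.

(** The form in which the Lipschitz bound is used: with the zeroth-order term
    [K * t] on both sides, the regularised equation becomes order preserving. *)
Lemma supconv_add_mono K t t' : 0 <= K -> t <= t' ->
  supconv K t + K * t <= supconv K t' + K * t'.
Proof.
move=> K0 tt; have := supconv_lip t t' K0.
by rewrite ler0_norm ?subr_le0// mulrN mulrBr; lra.
Qed.

Lemma supconv_continuous K : 0 <= K -> continuous (supconv K).
Proof.
move=> K0 t; apply/cvgrPdist_le => e e0.
have K1 : 0 < K + 1 by rewrite ltr_wpDl.
apply/nbhs_ballP; exists (e / (K + 1)) => /=; first by rewrite divr_gt0.
move=> s; rewrite /ball/= => ts.
have h : K * `|t - s| <= e.
  apply: (@le_trans _ _ ((K + 1) * `|t - s|)); first by rewrite ler_wpM2r// lerDl.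
  by rewrite mulrC -ler_pdivlMr//; exact: ltW.
have h1 := supconv_lip t s K0; have := supconv_lip s t K0; rewrite distrC => h2.
by rewrite ler_norml; apply/andP; split; lra.
Qed.

Lemma supconv_approx (e : R) : 0 < e -> exists2 K0 : R, 0 <= K0 &
  forall K t, K0 <= K -> `|t| <= W -> supconv K t <= f t + e.
Proof.
move=> e0; have [eta eta0 heta] := unif_continuous_itv e0.
have B0 : 0 <= B by apply: le_trans (fB (_ : `|0| <= W)); rewrite ?normr0.
exists (2 * B / eta); first by rewrite divr_ge0 ?mulr_ge0// ltW.
move=> K t KK tW; have K0 : 0 <= K by apply: le_trans KK; rewrite divr_ge0 ?mulr_ge0// ltW.
apply: supconv_le => s sW; have [st|st] := ltP `|s - t| eta.
  by apply: le_trans (heta _ _ sW tW st); rewrite gerBl mulr_ge0.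
have : 2 * B <= K * `|s - t|.
  rewrite ler_pdivrMr// in KK; apply: le_trans KK _; exact: ler_wpM2l.
have := fB sW; have := fB tW; rewrite !ler_norml => /andP[h1 h2] /andP[h3 h4].
by lra.
Qed.

End bounds.

End sup_convolution.

(** * Monotone iteration from the barrier *)

Section monotone_iteration.
Context {R : realType} {d : nat}.
Local Notation E := 'rV[R]_d.
Local Notation mu := (@lebesgue_rV R d).
Variable Om : set E.
Hypotheses (oO : open Om) (bO : bounded_set Om).
Implicit Types (u v : E -> R) (Du Dv : E -> E).
Local Notation sq := (sqint mu Om).
Local Notation ip := (ip mu Om).
Local Notation nrm2 f := (ip f f).
Let mOm := open_measurable_rV oO.
Let finOm := bounded_rV_lty mOm bO.
Local Hint Resolve mOm finOm : core.

Variables (f : R -> R) (q : E -> R) (W B m C k0 : R).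
Hypotheses (cf : continuous f) (W0 : 0 <= W)
  (fB : forall s, `|s| <= W -> `|f s| <= B).
Hypotheses (smq : smooth q) (q0 : forall x, Om x -> 0 <= q x)
  (qW : forall x, Om x -> q x <= W) (C0 : 0 <= C)
  (dq : forall i x, Om x -> `|partial i q x| <= C * q x)
  (lapq : forall psi, test_function Om psi ->
    \sum_(i < d) ip (partial i q) (partial i psi) = ip (fun=> m) psi).
Hypotheses (k00 : 0 < k0)
  (fq_low : forall x, Om x -> - m <= f (- q x))
  (fq_up : forall x, Om x -> supconv f W k0 (q x) <= m).

Lemma ip_ae g g' h : {ae mu, forall x, Om x -> g x = g' x} ->
  sq g -> sq g' -> sq h -> ip g h = ip g' h.
Proof.
move=> gg sg sg' sh; rewrite !ipE /Rintegral; congr fine.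
have mm a : sq a -> measurable_fun Om (fun x => (a x * h x)%:E).
  by move=> [ma _]; apply: measurable_EFin; apply: measurable_funM => //; case: sh.
apply: ae_eq_integral => //; [exact: mm|exact: mm|].
by apply: filterS gg => x hx Ox; rewrite hx.
Qed.

(* The Lipschitz constant of the n-th regularisation, and also the coefficient
   of the zeroth-order term in the n-th linear problem. *)
Let lam n := k0 + n%:R.
Let lam0 n : 0 < lam n. Proof. by rewrite /lam ltr_pwDl. Qed.
Let F n := supconv f W (lam n).

Lemma trapped_norm (u : E -> R) x : - q x <= u x <= q x -> Om x -> `|u x| <= W.
Proof.
by move=> /andP[u1 u2] Ox; have := qW Ox; rewrite ler_norml => h; apply/andP; split; lra.
Qed.

Lemma measurable_F n u : measurable_fun Om u -> measurable_fun Om (fun x => F n (u x)).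
Proof.
move=> mu'; apply: (@measurableT_comp _ _ _ _ _ _ (F n)) => //.
by apply: continuous_measurable_fun; apply: (supconv_continuous W0 fB); exact: ltW.
Qed.

(** [u] is trapped between the barriers and is a weak supersolution of the
    problem for the [n]-th regularised nonlinearity, with [r] as [- Delta u].
    The multiple [c] of the barrier [q] lets the iteration start at [q] itself,
    which does not vanish on the boundary. *)
Definition supersolution n u := [/\ measurable_fun Om u,
  forall x, Om x -> - q x <= u x <= q x &
  exists h Dh c r, [/\ H10 Om h Dh, 0 <= c, forall x, Om x -> u x = h x + c * q x,
    (sq r /\ forall x, Om x -> F n (u x) <= r x) &
    forall psi, test_function Om psi ->
      \sum_(i < d) ip (fun x => Dh x ord0 i + c * partial i q x) (partial i psi) = ip r psi]].

Lemma supersolution_barrier : supersolution 0 q.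
Proof.
split; first by apply: continuous_measurable_Om => //; exact: smooth_continuous.
  by move=> x Ox; rewrite lexx andbT; have := q0 Ox; lra.
exists (0 : E -> R), (grad (0 : E -> R)), 1, (fun=> m); split => //.
- by apply: H10_test => //; exact: test0.
- by move=> x _; rewrite mul1r -[LHS]add0r.
- split; first exact: sqint_cst.
  by move=> x Ox; rewrite /F /lam addr0; exact: fq_up.
- move=> psi tp; rewrite -lapq//; apply: eq_bigr => i _; apply: eq_ip => // x _.
  by rewrite mxE mul1r (_ : partial i (0 : E -> R) x = 0) ?add0r// partial_cst.
Qed.

Definition next_iterate n u v Dv := [/\ measurable_fun Om v,
  (forall x, Om x -> - q x <= v x), (forall x, Om x -> v x <= u x), H10 Om v Dv &
  weak_laplace Om Dv (fun x => F n (u x) + lam n * (u x - v x))].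

(** The linear problem gives [w] with [- Delta w + lam w = F u + lam u].
    Comparing with [u] uses that [u] is a supersolution; comparing with [- q]
    uses that [F + lam] is increasing and that [- q] is a subsolution. *)
Lemma iterate_exists n u : supersolution n u -> exists v Dv, next_iterate n u v Dv.
Proof.
move=> [mu' trap [h [Dh [c [r [hH c0 uE [sr Fr] eqh]]]]]].
have ln0 := lam0 n; have l0 := ltW ln0.
have uW x : Om x -> `|u x| <= W by move=> Ox; exact: trapped_norm (trap _ Ox) Ox.
have su : sq u := sqint_bounded mOm finOm mu' uW.
have sF : sq (fun x => F n (u x)).
  apply: (sqint_bounded mOm finOm (measurable_F n mu')) => x Ox.
  by apply: (supconv_norm_le W0 fB) => //; exact: uW.
have slu : sq (fun x => lam n * u x) by exact: sqintZ.
have sg : sq (fun x => F n (u x) + lam n * u x) by exact: sqintD.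
have [w [Dw [hw eqw]]] := solve_linear oO bO ln0 sg.
have sw := H10_sq hw; have sDw i := H10_sqD i hw.
have sh := H10_sq hH; have sDh i := H10_sqD i hH.
have slw : sq (fun x => lam n * w x) by exact: sqintZ.
have ssq := smooth_sqint oO bO smq.
have sspq i : sq (partial i q) by exact/smooth_sqint/smooth_partial.
have scpq i : sq (fun x => c * partial i q x) by exact: sqintZ.
have up : {ae mu, forall x, Om x -> w x <= u x}.
  have hd := H10_lin oO bO (-1) hw hH.
  have smcq : smooth (c *: q) by exact: smoothZ.
  have pcq i x : partial i (c *: q) x = c * partial i q x.
    by rewrite smooth_partialZ.
  have ae1 : {ae mu, forall x, Om x -> w x + (-1) * h x <= (c *: q) x}.
    apply: (@comparison _ _ _ oO bO _ _ (c *: q) (fun x => F n (u x) - r x) C (lam n) hd smcq) => //.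
    - by move=> x Ox; rewrite -[leRHS]/(c * q x) mulr_ge0// q0.
    - move=> i x Ox; rewrite pcq normrM (ger0_norm c0) -[leRHS]/(C * (c * q x)) mulrCA.
      by rewrite ler_wpM2l// dq.
    - exact: sqintB.
    - by move=> x Ox; rewrite subr_le0 Fr.
    - move=> psi tp; have sp := smooth_sqint oO bO (test_smooth tp).
      have spp i : sq (partial i psi) by exact/smooth_sqint/smooth_partial/(test_smooth tp).
      have e1 := eqw _ tp; have e2 := eqh _ tp.
      rewrite (eq_bigr (fun i => ip (fun x => Dw x ord0 i) (partial i psi) -
          ip (fun x => Dh x ord0 i + c * partial i q x) (partial i psi))); last first.
        move=> i _; rewrite -ipBl//; last exact: sqintD.
        by apply: eq_ip => // x _; rewrite !mxE pcq; ring.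
      rewrite big_split/= sumrN e1 e2.
      have -> : lam n * ip (fun x => w x + -1 * h x - (c *: q) x) psi =
                ip (fun x => lam n * (w x - u x)) psi.
        rewrite -ipZl//; first by apply: eq_ip => // x Ox; rewrite uE// -[(c *: q) x]/(c * q x); ring.
        by apply: sqintB; [|apply: sqintD => //; exact: sqintZ|exact: smooth_sqint].
      rewrite -ipBl//; last exact: sqintB.
      rewrite -ipDl//; first by apply: eq_ip => // x _; ring.
        by apply: sqintB => //; exact: sqintB.
      by apply: sqintZ => //; exact: sqintB.
  apply: filterS ae1 => x hx Ox; have := hx Ox; rewrite uE// -[(c *: q) x]/(c * q x); lra.
have low : {ae mu, forall x, Om x -> - q x <= w x}.
  (* This is - w. *)
  have hd := H10_lin oO bO (-2) hw hw.
  have ae1 : {ae mu, forall x, Om x -> w x + (-2) * w x <= q x}.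
    apply: (@comparison _ _ _ oO bO _ _ q (fun x => - (F n (u x) + lam n * u x) - (m + lam n * q x)) C (lam n) hd smq) => //.
    - apply: sqintB => //; first exact: sqintN.
      by apply: sqintD => //; [exact: sqint_cst|exact: sqintZ].
    - move=> x Ox; have /andP[u1 u2] := trap _ Ox.
      have mono := supconv_add_mono W0 fB l0 u1; rewrite -/(F n) in mono.
      have qn : `|- q x| <= W by rewrite normrN ger0_norm ?q0// qW.
      have := supconv_ge fB l0 qn; rewrite -/(F n) => h1.
      have := fq_low Ox; move: mono; rewrite mulrN; lra.
    - move=> psi tp; have sp := smooth_sqint oO bO (test_smooth tp).
      have spp i : sq (partial i psi) by exact/smooth_sqint/smooth_partial/(test_smooth tp).
      have e1 := eqw _ tp; have e2 := lapq tp.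
      rewrite (eq_bigr (fun i => - ip (fun x => Dw x ord0 i) (partial i psi) -
          ip (partial i q) (partial i psi))); last first.
        move=> i _; rewrite -ipNl// -ipBl//; last exact: sqintN.
        by apply: eq_ip => // x _; rewrite !mxE; ring.
      rewrite big_split/= !sumrN e1 e2.
      have sm := sqint_cst mOm finOm m.
      rewrite -ipNl//; last exact: sqintB.
      rewrite -ipBl//; last by apply: sqintN => //; exact: sqintB.
      have swq : sq (fun x => w x + -2 * w x - q x).
        by apply: sqintB => //; apply: sqintD => //; exact: sqintZ.
      rewrite -ipZl// -ipDl//; first by apply: eq_ip => // x _; ring.
        by apply: sqintB => //; apply: sqintN => //; exact: sqintB.
      exact: sqintZ.
  by apply: filterS ae1 => x hx Ox; have := hx Ox; lra.
(* The bounds hold almost everywhere; this modification makes them hold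
   everywhere. *)
pose v x := Num.min (u x) (Num.max (w x) (- q x)).
have mq : measurable_fun Om (fun x => - q x) by apply: measurable_funN; case: ssq.
have mw : measurable_fun Om w by case: sw.
have mv : measurable_fun Om v.
  by apply: measurable_minr => //; exact: measurable_maxr.
have wv : {ae mu, forall x, Om x -> w x = v x}.
  apply: filterS2 up low => x h1 h2 Ox; have {}h1 := h1 Ox; have {}h2 := h2 Ox.
  by rewrite /v (max_l h2) (min_r h1).
have vu x : v x <= u x by rewrite /v ge_min lexx.
have qv x : Om x -> - q x <= v x.
  by move=> Ox; have /andP[u1 u2] := trap _ Ox; rewrite /v le_min u1 le_max lexx orbT.
have hv := H10_ext oO bO wv mv hw; have sv := H10_sq hv.
exists v, Dw; split => // psi tp; have sp := smooth_sqint oO bO (test_smooth tp).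
rewrite (eqw _ tp); apply: ip_ae => //.
- by apply: filterS wv => x hx Ox; rewrite (hx Ox); ring.
- exact: sqintB.
- by apply: sqintD => //; apply: sqintZ => //; exact: sqintB.
Qed.

Lemma next_supersolution n u v Dv : supersolution n u -> next_iterate n u v Dv ->
  supersolution n.+1 v.
Proof.
move=> [mu' trap _] [mv qv vu hv eqv]; have l0 := ltW (lam0 n).
have trapv x : Om x -> - q x <= v x <= q x.
  move=> Ox; rewrite qv//=; apply: le_trans (vu _ Ox) _.
  by have /andP[] := trap _ Ox.
have uW x : Om x -> `|u x| <= W by move=> Ox; exact: trapped_norm (trap _ Ox) Ox.
have su : sq u := sqint_bounded mOm finOm mu' uW.
have sv := H10_sq hv; have sDv i := H10_sqD i hv.
have sF : sq (fun x => F n (u x)).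
  apply: (sqint_bounded mOm finOm (measurable_F n mu')) => x Ox.
  by apply: (supconv_norm_le W0 fB) => //; exact: uW.
split => //; exists v, Dv, 0, (fun x => F n (u x) + lam n * (u x - v x)); split => //.
- by move=> x _; rewrite mul0r addr0.
- split; first by apply: sqintD => //; apply: sqintZ => //; exact: sqintB.
  move=> x Ox; have ll : lam n <= lam n.+1 by rewrite lerD2l ler_nat.
  apply: le_trans (supconv_antitone W0 fB (v x) l0 ll) _.
  have := supconv_add_mono W0 fB l0 (vu _ Ox); rewrite -/(F n) mulrBr; lra.
- move=> psi tp; rewrite -(eqv _ tp); apply: eq_bigr => i _; apply: eq_ip => // x _.
  by rewrite mul0r addr0.
Qed.

Lemma iterates_exist : exists (u : nat -> E -> R) (Du : nat -> E -> E),
  u 0%N = q /\ forall n, supersolution n (u n) /\ next_iterate n (u n) (u n.+1) (Du n.+1).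
Proof.
have /choice[G hG] (p : nat * (E -> R)) : exists vD : (E -> R) * (E -> E),
    supersolution p.1 p.2 -> next_iterate p.1 p.2 vD.1 vD.2.
  have [sp|nsp] := pselect (supersolution p.1 p.2); last by exists (q, fun=> 0).
  by have [v [Dv h]] := iterate_exists sp; exists (v, Dv).
pose s := fix s n : (E -> R) * (E -> E) := if n is n'.+1 then G (n', (s n').1) else (q, fun=> 0).
have hs n : supersolution n (s n).1.
  elim: n => [|n IH]; first exact: supersolution_barrier.
  exact: next_supersolution IH (hG (n, (s n).1) IH).
exists (fun n => (s n).1), (fun n => (s n).2); split => // n; split => //.
exact: (hG (n, (s n).1) (hs n)).
Qed.

End monotone_iteration.

(** * The limit of the iterates *)

(** The increments of a bounded monotone sequence are summable, and the
    harmonic series is not. *)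
Lemma small_weighted_increment (R : realType) (b : nat -> R) (A k0 e : R) (m : nat) :
  (forall n, b n.+1 <= b n) -> (forall n, `|b n| <= A) -> 0 < k0 -> 0 < e ->
  exists2 n, (m <= n)%N & (k0 + n%:R) * (b n - b n.+1) <= e.
Proof.
move=> bdec bA k00 e0; apply: contrapT => H.
have {}H n : e < (k0 + (n + m)%:R) * (b (n + m)%N - b (n + m).+1).
  rewrite ltNge; apply/negP => h; apply: H; exists (n + m)%N => //; exact: leq_addl.
pose c := k0 + m%:R + 1.
have c1 : 1 <= c by rewrite /c lerDr addr_ge0// ltW.
have hb n : harmonic n <= c / e * (b (n + m)%N - b (n + m).+1) :> R.
  have kn : 0 < k0 + (n + m)%:R by rewrite ltr_pwDl.
  have kc : k0 + (n + m)%:R <= c * n.+1%:R.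
    rewrite natrD -natr1 mulrDr mulr1.
    have : n%:R <= c * n%:R by rewrite ler_peMl.
    by rewrite /c; lra.
  have := H n; rewrite mulrC -ltr_pdivrMr// => /ltW h.
  have ce : 0 <= c / e by rewrite divr_ge0 ?ltW// (lt_le_trans ltr01).
  apply: le_trans (ler_wpM2l ce h).
  rewrite mulrA divfK ?gt_eqF// /harmonic/= ler_pdivlMr// mulrC ler_pdivrMr//.
have hs N : series (@harmonic R) N <= c / e * (2 * A).
  apply: (@le_trans _ _ (\sum_(0 <= n < N) c / e * (b (n + m)%N - b (n + m).+1))).
    by apply: ler_sum => n _; exact: hb.
  rewrite -mulr_sumr ler_wpM2l//; first by rewrite divr_ge0 ?ltW// (lt_le_trans ltr01).
  have -> : \sum_(0 <= n < N) (b (n + m)%N - b (n + m).+1) = b m - b (N + m)%N.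
    rewrite -[RHS]opprB -(@telescope_sumr _ 0 N (fun n => b (n + m)%N))// -sumrN.
    by apply: eq_bigr => n _; rewrite opprB addSn.
  by have := bA m; have := bA (N + m)%N; rewrite !ler_norml => /andP[h1 h2] /andP[h3 h4]; lra.
apply: (@dvg_harmonic R); apply: nondecreasing_is_cvgn.
  by apply/nondecreasing_seqP => n; rewrite seriesSr lerDl /harmonic/= invr_ge0.
by exists (c / e * (2 * A)) => _ [n _ <-]; exact: hs.
Qed.

Section limit_of_iterates.
Context {R : realType} {d : nat}.
Local Notation E := 'rV[R]_d.
Local Notation mu := (@lebesgue_rV R d).
Variable Om : set E.
Hypotheses (oO : open Om) (bO : bounded_set Om).
Local Notation sq := (sqint mu Om).
Local Notation ip := (ip mu Om).
Local Notation l1 := (l1 mu Om).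
Local Notation nrm2 f := (ip f f).
Let mOm := open_measurable_rV oO.
Let finOm := bounded_rV_lty mOm bO.
Local Hint Resolve mOm finOm : core.

Variables (f : R -> R) (W B k0 : R).
Hypotheses (cf : continuous f) (W0 : 0 <= W)
  (fB : forall s, `|s| <= W -> `|f s| <= B) (k00 : 0 < k0).
Let lam n := k0 + n%:R.
Let F n := supconv f W (lam n).
Variables (u : nat -> E -> R) (Du : nat -> E -> E).
Hypotheses (mu_ : forall n, measurable_fun Om (u n))
  (uW : forall n x, Om x -> `|u n x| <= W)
  (udec : forall n x, Om x -> u n.+1 x <= u n x)
  (uH : forall n, H10 Om (u n.+1) (Du n.+1))
  (ueq : forall n, weak_laplace Om (Du n.+1)
    (fun x => F n (u n x) + lam n * (u n x - u n.+1 x))).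

Let lam0 n : 0 < lam n. Proof. by rewrite /lam ltr_pwDl. Qed.
Let G n x := F n (u n x) + lam n * (u n x - u n.+1 x).
Let su n : sq (u n) := sqint_bounded mOm finOm (@mu_ n) (@uW n).

Let mF n : measurable_fun Om (fun x => F n (u n x)).
Proof.
apply: (@measurableT_comp _ _ _ _ _ _ (F n)) => //.
by apply: continuous_measurable_fun; apply: (supconv_continuous W0 fB); exact: ltW.
Qed.

Let FB n x : Om x -> `|F n (u n x)| <= B.
Proof. by move=> Ox; apply: (supconv_norm_le W0 fB); [exact: ltW|exact: uW]. Qed.

Let sF n : sq (fun x => F n (u n x)) := sqint_bounded mOm finOm (@mF n) (@FB n).

Let sG n : sq (G n).
Proof. by apply: sqintD => //; apply: sqintZ => //; exact: sqintB. Qed.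

Let v x := inf (range (u ^~ x)).

Let uv x : Om x -> u ^~ x @ \oo --> v x.
Proof.
move=> Ox; apply: nonincreasing_cvgn; first by apply/nonincreasing_seqP => n; exact: udec.
by exists (- W) => _ [n _ <-]; have := uW n Ox; rewrite ler_norml => /andP[].
Qed.

Let mv : measurable_fun Om v. Proof. exact: measurable_fun_cvg mu_ uv. Qed.

Let vW x : Om x -> `|v x| <= W.
Proof.
move=> Ox; have cn : `|u n x| @[n --> \oo] --> `|v x|.
  exact: (cvg_comp _ _ (uv Ox) (@norm_continuous _ R^o (v x))).
rewrite -(cvg_lim _ cn)//; apply: limr_le; first by apply/cvg_ex; exists `|v x|.
by apply: nearW => n; exact: uW.
Qed.

Let sv : sq v := sqint_bounded mOm finOm mv vW.

Let mfv : measurable_fun Om (f \o v).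
Proof. by apply: measurableT_comp => //; exact: continuous_measurable_fun. Qed.

Let sfv : sq (f \o v) := sqint_bounded mOm finOm mfv (fun x Ox => fB (vW Ox)).

(** The regularised nonlinearities converge along the iterates: they are
    uniformly close to [f] on the range of the iterates. *)
Let Fcvg x : Om x -> F n (u n x) @[n --> \oo] --> f (v x).
Proof.
move=> Ox; apply/cvgrPdist_le => e e0; have e2 : 0 < e / 2 by rewrite divr_gt0.
have [K0 K00 hK] := supconv_approx cf W0 fB e2.
have fc : f (u n x) @[n --> \oo] --> f (v x).
  exact: (cvg_comp _ _ (uv Ox) (@cf (v x))).
have [N1 _ h1] : \forall n \near \oo, `|f (v x) - f (u n x)| <= e / 2.
  by move/cvgrPdist_le : fc => /(_ _ e2).
have [N2 _ h2] : \forall n \near \oo, K0 <= n%:R.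
  exact: nbhs_infty_ger.
exists (maxn N1 N2) => // n /=; rewrite geq_max => /andP[n1 n2].
have l0 := ltW (lam0 n).
have a1 := h1 n n1; have a2 := h2 n n2.
have a3 := supconv_ge fB l0 (uW n Ox); rewrite -/(F n) in a3.
have Kn : K0 <= lam n by apply: le_trans a2 _; rewrite lerDr ltW.
have a4 := hK _ _ Kn (uW n Ox); rewrite -/(F n) in a4.
by move: a1; rewrite !ler_norml => /andP[b1 b2]; apply/andP; split; lra.
Qed.

(** The sources [G n] are not the regularised nonlinearities but differ from them
    by a multiple, growing like [n], of the decrement of the iterates; this
    correction is small for infinitely many [n] only. *)
Let l1_G (e : R) (m : nat) : 0 < e -> exists2 n, (m <= n)%N & l1 (fun x => G n x - f (v x)) <= e.
Proof.
move=> e0; have e2 : 0 < e / 2 by rewrite divr_gt0.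
have s1 := sqint_cst mOm finOm 1.
have [N hN] := bounded_cvg_l1 mOm finOm mF FB Fcvg e2.
pose b n := ip (u n) (fun=> 1).
have bdec n : b n.+1 <= b n.
  by apply: le_ip => //; [exact: integM|exact: integM|move=> x Ox; rewrite !mulr1 udec].
pose A := W * l1 (fun=> 1).
have bA n : `|b n| <= A.
  by rewrite /b ipC; apply: ip_l1 => // x Ox; exact: uW.
have [n mn hn] := small_weighted_increment (maxn m N) bdec bA k00 e2.
move: mn; rewrite geq_max => /andP[mn Nn]; exists n => //.
have su' : sq (fun x => u n x - u n.+1 x) by exact: sqintB.
have slu : sq (fun x => lam n * (u n x - u n.+1 x)) by exact: sqintZ.
have sFf : sq (fun x => F n (u n x) - f (v x)) by apply: sqintB.
have -> : l1 (fun x => G n x - f (v x)) =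
    l1 (fun x => (F n (u n x) - f (v x)) + lam n * (u n x - u n.+1 x)).
  by apply: eq_ip => // x _; rewrite /G; congr (`|_|); ring.
apply: le_trans (l1D mOm finOm sFf slu) _.
have -> : l1 (fun x => lam n * (u n x - u n.+1 x)) = lam n * (b n - b n.+1).
  rewrite /b -ipBl// -ipZl//; apply: eq_ip => // x Ox.
  by rewrite ger0_norm// mulr_ge0 ?(ltW (lam0 n))// subr_ge0 udec.
by have := hN n Nn; move: hn; rewrite -/(lam n); lra.
Qed.

Let nrm2_u (e : R) : 0 < e -> exists N, forall n, (N <= n)%N -> nrm2 (fun x => u n x - v x) <= e.
Proof.
move=> e0; have W1 : 0 < 2 * W + 1 by rewrite ltr_wpDl// mulr_ge0.
have ec : 0 < e / (2 * W + 1) by rewrite divr_gt0.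
have [N hN] := bounded_cvg_l1 mOm finOm mu_ uW uv ec; exists N => n Nn.
have sd : sq (fun x => u n x - v x) by exact: sqintB.
apply: le_trans (ler_norm _) _; apply: le_trans.
  apply: (ip_l1 mOm finOm (C := 2 * W + 1) sd sd) => x Ox.
  apply: le_trans (ler_normB _ _) _.
  by have := uW n Ox; have := vW Ox; lra.
by have := hN n Nn; rewrite ler_pdivlMr// mulrC.
Qed.

(** Along indices where the sources converge in mean, their difference tested
    against the bounded difference of the iterates controls the gradients. *)
Lemma limit_solution : exists (w : E -> R) (Dw : E -> E),
  [/\ H10 Om w Dw, sq (f \o w) & weak_laplace Om Dw (f \o w)].
Proof.
have s1 := sqint_cst mOm finOm 1.
have /choice[nu hnu] j : exists n, (j <= n)%N /\ l1 (fun x => G n x - f (v x)) <= j.+1%:R^-1.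
  have j0 : 0 < j.+1%:R^-1 :> R by rewrite invr_gt0.
  by have [n jn h] := l1_G j j0; exists n.
pose w j := u (nu j).+1; pose Dw j := Du (nu j).+1; pose g j := G (nu j).
have hw j : H10 Om (w j) (Dw j) by exact: uH.
have eqw j : weak_laplace Om (Dw j) (g j) by exact: ueq.
have sw j := H10_sq (hw j); have sDw j i := H10_sqD i (hw j).
have sg j : sq (g j) by exact: sG.
have gl1 j : l1 (fun x => g j x - f (v x)) <= j.+1%:R^-1 by case: (hnu j).
have sgf j : sq (fun x => g j x - f (v x)) by apply: sqintB.
have wW j x : Om x -> `|w j x| <= W by exact: uW.
have grad_diff j l : \sum_(i < d) nrm2 (fun x => Dw j x ord0 i - Dw l x ord0 i) <=
    2 * W * (j.+1%:R^-1 + l.+1%:R^-1).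
  have sd : sq (fun x => g j x - g l x) by exact: sqintB.
  have hd := H10_lin oO bO (-1) (hw j) (hw l).
  have eqd : weak_laplace Om (fun x => Dw j x + (-1) *: Dw l x) (fun x => g j x - g l x).
    move=> psi tp; have sp := smooth_sqint oO bO (test_smooth tp).
    have spp i : sq (partial i psi) by exact/smooth_sqint/smooth_partial/(test_smooth tp).
    rewrite ipBl// -(eqw j _ tp) -(eqw l _ tp) -sumrB; apply: eq_bigr => i _.
    by rewrite -ipBl//; apply: eq_ip => // x _; rewrite !mxE; ring.
  have := weak_laplace_H10 oO bO (fun i => H10_sqD i hd) sd eqd hd.
  rewrite (eq_bigr (fun i => nrm2 (fun x => Dw j x ord0 i - Dw l x ord0 i))) => [->|i _]; last first.
    by apply: eq_ip => x _; rewrite !mxE mulN1r.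
  apply: le_trans (ler_norm _) _; apply: le_trans.
    apply: (ip_l1 mOm finOm (C := 2 * W) sd (H10_sq hd)) => x Ox.
    apply: le_trans (ler_normD _ _) _; rewrite mulN1r normrN.
    by have := wW j x Ox; have := wW l x Ox; lra.
  rewrite ler_wpM2l ?mulr_ge0//.
  have -> : l1 (fun x => g j x - g l x) = l1 (fun x => (g j x - f (v x)) + - (g l x - f (v x))).
    by apply: eq_ip => // x _; congr (`|_|); ring.
  apply: le_trans (l1D mOm finOm (sgf j) (sqintN mOm (sgf l))) _; apply: lerD => //.
  rewrite (_ : l1 _ = l1 (fun x => g l x - f (v x)))//.
  by apply: eq_ip => // x _; rewrite normrN.
have small (e : R) : 0 < e -> exists N, forall n, (N <= n)%N -> n.+1%:R^-1 <= e.
  move=> e0; have [N _ hN] := near_infty_natSinv_lt (PosNum e0).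
  by exists N => n Nn; apply/ltW/hN.
have cD i : cauchy2 mu Om (fun j x => Dw j x ord0 i).
  move=> e e0; have W1 : 0 < 4 * W + 1 by rewrite ltr_wpDl// mulr_ge0.
  have [N hN] := small (e / (4 * W + 1)) (divr_gt0 e0 W1).
  exists N => j l Nj Nl; apply: (@le_trans _ _ (2 * W * (j.+1%:R^-1 + l.+1%:R^-1))).
    apply: le_trans (grad_diff j l); rewrite (bigD1 i)//= lerDl.
    by apply: sumr_ge0 => k _; exact: ipff_ge0.
  move: (hN j Nj) (hN l Nl); rewrite !ler_pdivlMr//.
  have : 0 <= j.+1%:R^-1 :> R by rewrite invr_ge0.
  have : 0 <= l.+1%:R^-1 :> R by rewrite invr_ge0.
  by move: (j.+1%:R^-1) (l.+1%:R^-1) => r s r0 s0; nra.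
have /choice[V hV] i : exists l, sq l /\ forall e : R, 0 < e ->
    exists N, forall n, (N <= n)%N -> nrm2 (fun x => Dw n x ord0 i - l x) <= e.
  by have [l sl hl] := sqint_complete mOm (fun n => sDw n i) (cD i); exists l.
pose DV x : E := \row_i V i x.
have DvE i : (fun x => DV x ord0 i) = V i by apply/funext => x; rewrite mxE.
have sV i : sq (V i) by case: (hV i).
have hall e : 0 < e -> exists N, forall n, (N <= n)%N -> nrm2 (fun x => w n x - v x) <= e /\
    forall i, nrm2 (fun x => Dw n x ord0 i - V i x) <= e.
  move=> e0; have [N hN] := nrm2_u e0.
  have /choice[M hM] i : exists N, forall n, (N <= n)%N ->
    nrm2 (fun x => Dw n x ord0 i - V i x) <= e by have [_] := hV i; apply.
  exists (maxn N (\max_i M i)) => n; rewrite geq_max => /andP[Nn Mn]; split.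
    by apply: hN; apply: leq_trans Nn _; apply: leq_trans (leqnSn _); case: (hnu n).
  by move=> i; apply: hM; apply: leq_trans Mn; exact: leq_bigmax.
have hH : H10 Om v DV.
  apply: H10_closed => // [i|e e0]; first by rewrite DvE.
  have [N /(_ N (leqnn _))[h1 h2]] := hall _ e0; exists (w N), (Dw N); split => // i.
  rewrite (_ : nrm2 _ = nrm2 (fun x => Dw N x ord0 i - V i x))//.
  by apply: eq_ip => x _; rewrite mxE.
exists v, DV; split => // psi tp; have spsi := test_sqint oO bO tp.
have spp i : sq (partial i psi) by exact/smooth_sqint/smooth_partial/(test_smooth tp).
have [Cp hCp] := test_bounded tp.
pose K := \sum_(i < d) Num.sqrt (nrm2 (partial i psi)) + `|Cp|.
apply: (@eq_of_small _ _ _ K) => e e0.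
have e2 : 0 < e ^+ 2 by rewrite exprn_gt0.
have [N hN] := hall _ e2; have [M hM] := small _ e0.
have [_ h2] := hN (maxn N M) (leq_maxl _ _); have h3 := hM (maxn N M) (leq_maxr _ _).
set n := maxn N M in h2 h3.
have se : Num.sqrt (e ^+ 2) = e by rewrite sqrtr_sqr gtr0_norm.
have -> : \sum_(i < d) ip (fun x => DV x ord0 i) (partial i psi) - ip (f \o v) psi =
    - \sum_(i < d) (ip (fun x => Dw n x ord0 i) (partial i psi) - ip (V i) (partial i psi)) +
    ip (fun x => g n x - f (v x)) psi.
  rewrite (ipBl mOm (sg n) sfv spsi) -(eqw n _ tp) sumrB.
  by under eq_bigr do rewrite DvE; ring.
rewrite /K mulrDr; apply: le_trans (ler_normD _ _) _; apply: lerD.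
  rewrite normrN; apply: le_trans (ler_norm_sum _ _ _) _.
  rewrite mulr_sumr; apply: ler_sum => i _; rewrite -[X in X * _]se.
  exact: nrm2_le_cvg.
apply: le_trans.
  apply: (ip_l1 mOm finOm (C := `|Cp|) (sgf n) spsi) => x _.
  by apply: le_trans (hCp x) _; exact: ler_norm.
rewrite mulrC ler_wpM2r//; exact: le_trans (gl1 n) h3.
Qed.

End limit_of_iterates.

(** * The barrier *)

(** This is where sublinear growth enters: for [beta < 1] the right-hand side
    outgrows the left-hand side. *)
Lemma exists_barrier_height (R : realType) (C_0 beta c : R) :
  0 < C_0 -> 0 <= beta < 1 -> 1 <= c ->
  exists2 M, 0 < M & C_0 * (1 + (M * c) `^ beta) + 1 <= 2 * M.
Proof.
move=> C00 /andP[b0 b1] c1; have c0 : 0 <= c by exact: le_trans c1.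
pose Y := 1 + 2 * C_0 * c `^ beta + C_0 + 1.
have cb0 : 0 <= C_0 * c `^ beta by rewrite mulr_ge0 ?powR_ge0// ltW.
have Y1 : 1 <= Y by rewrite /Y -[X in _ <= X]/(_ + _ + _ + _) -mulrA; lra.
have Y0 : 0 < Y by exact: lt_le_trans Y1.
have s0 : 0 < 1 - beta by rewrite subr_gt0.
(* Chosen so that M ^ beta = M / Y. *)
pose M := Y `^ (1 - beta)^-1.
have YM : Y <= M.
  have s1 : 1 <= (1 - beta)^-1 by rewrite -[leLHS]invr1 lef_pV2 ?posrE//; lra.
  by have := ler_powR Y1 s1; rewrite powRr1// ltW.
have M0 : 0 < M by exact: lt_le_trans YM.
have MY : M `^ beta * Y = M.
  have E : (1 - beta)^-1 * beta + 1 = (1 - beta)^-1 by field; rewrite gt_eqF.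
  transitivity (Y `^ ((1 - beta)^-1 * beta + 1)); last by rewrite E.
  have nz : ((1 - beta)^-1 * beta + 1 == 0) ==> (Y != 0) by rewrite (gt_eqF Y0) implybT.
  by rewrite (powRD nz) powRrM powRr1// ltW.
exists M => //; rewrite powRM ?(ltW M0)//.
have h : C_0 * (M `^ beta * c `^ beta) <= M / 2.
  rewrite -[in leRHS]MY; have Yc : 2 * (C_0 * c `^ beta) <= Y by rewrite /Y -mulrA; lra.
  have := powR_ge0 M beta; move: (M `^ beta) => P P0.
  rewrite (_ : C_0 * (P * _) = P * (2 * (C_0 * c `^ beta)) / 2); last by field.
  by rewrite ler_wpM2r// ler_wpM2l.
have YC : C_0 + 1 <= Y by rewrite /Y -mulrA; lra.
by rewrite mulrDr mulr1; lra.
Qed.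

Lemma f_0_pos (R : realType) (f : R -> R) t : 0 < t -> f t <= f_0 f t.
Proof.
move=> t0; rewrite /f_0 !indicE mem_set// memNset/=; last by rewrite ltNge ltW.
by rewrite mulr1 mulr0 addr0 le_max lexx.
Qed.

Lemma f_0_neg (R : realType) (f : R -> R) t : t < 0 -> f_0 f t <= f t.
Proof.
move=> t0; rewrite /f_0 !indicE [t \in [set s | s < 0]]mem_set// memNset/=; last by rewrite ltNge ltW.
by rewrite mulr1 mulr0 add0r ge_min lexx.
Qed.

Section paraboloid.
Context {R : realType} {d : nat}.
Local Notation E := 'rV[R]_d.+1.
Local Notation mu := (@lebesgue_rV R d.+1).
Variables (Om : set E) (M b : R).
Hypotheses (oO : open Om) (bO : bounded_set Om).
Hypotheses (M0 : 0 < M) (b0 : 0 <= b) (Omb : forall x, Om x -> `|x| <= b).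
Local Notation ip := (ip mu Om).

Let x0 : E -> R := fun x => x ord0 ord0.

(** A concave function of one coordinate, with constant [- Delta] and bounded
    away from zero on the domain. *)
Definition paraboloid : E -> R := cst M \* (cst (b ^+ 2 + 1) \+ cst (-1) \* (x0 \* x0)).

Lemma paraboloid_smooth : smooth paraboloid.
Proof.
apply: smoothM; first exact: smooth_cst.
apply: smoothD; first exact: smooth_cst.
apply: smoothM; first exact: smooth_cst.
by apply: smoothM; exact: smooth_coord.
Qed.

Lemma paraboloidE x : paraboloid x = M * (b ^+ 2 + 1 - x0 x ^+ 2).
Proof. by rewrite /paraboloid /= mulN1r expr2. Qed.

Lemma partial_paraboloid i : partial i paraboloid = cst (- (2 * M * (i == ord0)%:R)) \* x0.
Proof.
have sx : smooth x0 by exact: smooth_coord.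
have s1 : smooth (cst (-1) \* (x0 \* x0)).
  by apply: smoothM; [exact: smooth_cst|exact: smoothM].
have s2 : smooth (cst (b ^+ 2 + 1) \+ cst (-1) \* (x0 \* x0)).
  exact: (smoothD (smooth_cst _) s1).
rewrite /paraboloid (smooth_partialM i (smooth_cst M) s2) (smooth_partialD i (smooth_cst _) s1).
rewrite (smooth_partialM i (smooth_cst _) (smoothM sx sx)) (smooth_partialM i sx sx) !partial_cst.
by rewrite partial_coord; apply/funext => x /=; ring.
Qed.

Lemma paraboloid_bounds x : Om x -> M <= paraboloid x <= M * (b ^+ 2 + 1).
Proof.
move=> Ox; have xb : `|x0 x| <= b by exact: le_trans (le_coord_norm x ord0) (Omb Ox).
have x2 : x0 x ^+ 2 <= b ^+ 2.
  by rewrite -[leLHS]real_normK ?num_real// lerXn2r ?nnegrE.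
rewrite paraboloidE; apply/andP; split.
  by rewrite -[leLHS]mulr1 ler_pM2l//; lra.
by rewrite ler_pM2l//; have := sqr_ge0 (x0 x); lra.
Qed.

Lemma paraboloid_grad i x : Om x -> `|partial i paraboloid x| <= 2 * b * paraboloid x.
Proof.
move=> Ox; have /andP[q1 _] := paraboloid_bounds Ox.
have xb : `|x0 x| <= b by exact: le_trans (le_coord_norm x ord0) (Omb Ox).
rewrite partial_paraboloid /= normrM normrN.
apply: (@le_trans _ _ (2 * M * b)); last by rewrite mulrAC ler_wpM2l// mulr_ge0.
apply: ler_pM => //; rewrite normrM [`|2 * M|]gtr0_norm ?mulr_gt0//.
have h : `|(i == ord0)%:R| <= 1 :> R by case: (i == ord0); rewrite ?normr1 ?normr0.
by rewrite -[leRHS]mulr1; apply: ler_wpM2l => //; rewrite ltW// mulr_gt0.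
Qed.

Lemma paraboloid_laplace psi : test_function Om psi ->
  \sum_(i < d.+1) ip (partial i paraboloid) (partial i psi) = ip (fun=> 2 * M) psi.
Proof.
move=> tp; rewrite big_ord_recl big1 => [|j _].
  rewrite addr0 (integration_by_parts_test oO bO _ _ tp); last first.
    exact/smooth_partial/paraboloid_smooth.
  have sp := smooth_sqint oO bO (test_smooth tp).
  have sx : smooth x0 by exact: smooth_coord.
  rewrite partial_paraboloid (smooth_partialM _ (smooth_cst _) sx) partial_cst partial_coord.
  rewrite -ipNl//; [|exact: open_measurable_rV|].
    by apply: eq_ip => // x _ /=; rewrite ?eqxx ?mulr1; ring.
  by rewrite (_ : _ \+ _ = cst (- (2 * M))); [exact/smooth_sqint/smooth_cst|
    apply/funext => x /=; rewrite ?eqxx ?mulr1; ring].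
rewrite (_ : partial _ paraboloid = fun=> 0); first by rewrite ip0l//; exact: open_measurable_rV.
by apply/funext => x; rewrite partial_paraboloid /= mulr0 oppr0 mul0r.
Qed.

End paraboloid.

(** * The existence theorem *)

Theorem proposition5p4 (R : realType) (d : nat) (Omega : set 'rV[R]_d)
    (f : R -> R) (C_H alpha C_0 beta : R) :
  (1 <= d)%N ->
  is_domain Omega -> bounded_set Omega -> convex_set Omega ->
  continuous f ->
  0 < C_H ->
  ((2 < d)%N -> 0 < alpha < (d%:R + 2) / (d%:R - 2)) ->
  ((d <= 2)%N -> 1 <= alpha) ->
  (forall t, `|f t| <= C_H * (1 + `|t| `^ alpha)) ->
  0 < C_0 ->
  0 <= beta < 1 ->
  (forall t, `|f_0 f t| <= C_0 * (1 + `|t| `^ beta)) ->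
  exists (u : 'rV[R]_d -> R) (Du : 'rV[R]_d -> 'rV[R]_d),
    H1_0 Omega u Du /\ weak_solution Omega f u Du.
Proof.
case: d Omega => // d Om _ [oO _ _] bO _ cf _ _ _ _ C00 beta01 hf0.
have [b b0 Omb] : exists2 b : R, 0 <= b & forall x, Om x -> `|x| <= b.
  have [b [_ hb]] := bO; exists (Num.max (b + 1) 0); first by rewrite le_max lexx orbT.
  by move=> x Ox; rewrite le_max (hb (b + 1)) ?ltrDl.
have c1 : 1 <= b ^+ 2 + 1 by rewrite lerDr sqr_ge0.
have [M M0 hM] := exists_barrier_height C00 beta01 c1.
pose q : 'rV[R]_d.+1 -> R := paraboloid M b; pose W := M * (b ^+ 2 + 1).
have W0 : 0 <= W by rewrite mulr_ge0 ?ltW// (lt_le_trans ltr01).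
have qb x : Om x -> M <= q x <= W := @paraboloid_bounds _ _ _ _ _ M0 b0 Omb x.
have q0 x : Om x -> 0 <= q x by move=> /qb/andP[+ _]; exact/le_trans/ltW.
have qW x : Om x -> q x <= W by move=> /qb/andP[].
have fgrowth t : 0 < t -> t <= W -> C_0 * (1 + t `^ beta) <= 2 * M - 1.
  move=> t0 tW; rewrite lerBrDr; apply: le_trans hM; rewrite lerD2r ler_pM2l// lerD2l.
  by apply: ge0_ler_powR; rewrite ?nnegrE ?(ltW t0)//; case/andP: beta01.
have qpos x : Om x -> 0 < q x by move=> /qb/andP[+ _]; exact: lt_le_trans.
have fq x : Om x -> f (q x) + 1 <= 2 * M.
  move=> Ox; have := f_0_pos f (qpos _ Ox); have := hf0 (q x).
  rewrite ler_norml (ger0_norm (q0 _ Ox)) => /andP[_ h1] h2.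
  by have := fgrowth _ (qpos _ Ox) (qW _ Ox); lra.
have fq_low x : Om x -> - (2 * M) <= f (- q x).
  move=> Ox; have qn : - q x < 0 by rewrite oppr_lt0 qpos.
  have := f_0_neg f qn; have := hf0 (- q x).
  rewrite ler_norml normrN (ger0_norm (q0 _ Ox)) => /andP[h1 _] h2.
  by have := fgrowth _ (qpos _ Ox) (qW _ Ox); lra.
have [B _ fB] := continuous_bounded_itv W cf.
have [K0 K00 hK] := supconv_approx cf W0 fB (@ltr01 R).
have k00 : 0 < K0 + 1 by rewrite ltr_wpDl.
have fq_up x : Om x -> supconv f W (K0 + 1) (q x) <= 2 * M.
  move=> Ox; apply: le_trans (fq _ Ox); apply: hK; first by rewrite lerDl.
  by rewrite ger0_norm ?q0// qW.
have smq : smooth q := paraboloid_smooth M b.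
have C0 : 0 <= 2 * b by rewrite mulr_ge0.
have [u [Du [_ hu]]] := @iterates_exist _ _ _ oO bO f q W B (2 * M) (2 * b) (K0 + 1)
  W0 fB smq q0 qW C0 (fun i x => @paraboloid_grad _ _ _ _ _ M0 b0 Omb i x)
  (@paraboloid_laplace _ _ _ _ _ oO bO) k00 fq_low fq_up.
have [w [Dw [hw sfw eqw]]] := @limit_solution _ _ _ oO bO f W B (K0 + 1) cf W0 fB k00 u Du
  (fun n => let: conj (And3 h _ _) _ := hu n in h)
  (fun n x Ox => let: conj (And3 _ h _) _ := hu n in trapped_norm qW (h x Ox) Ox)
  (fun n => let: conj _ (And5 _ _ h _ _) := hu n in h)
  (fun n => let: conj _ (And5 _ _ _ h _) := hu n in h)
  (fun n => let: conj _ (And5 _ _ _ _ h) := hu n in h).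
exists w, Dw; split; first exact: H10_H1_0.
move=> phi Dphi /(H1_0_H10 oO bO) hphi; have mO := open_measurable_rV oO; split.
  exact: (integM mO sfw (H10_sq hphi)).
rewrite (Rintegral_sum_ip mO (fun i => H10_sqD i hw) (fun i => H10_sqD i hphi)).
rewrite (weak_laplace_H10 oO bO (fun i => H10_sqD i hw) sfw eqw hphi).
exact: ipE.
Qed.
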